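(* Consider the billiard inside a convex domain in $\mathbb{R}^{m+1}$ bounded by a smooth hypersurface $M$, and let $\mathbf{x}=(x_1,\dots,x_n)$ be an $n$-periodic billiard trajectory. Suppose $(-1)^{m+n+\operatorname{ind}\mathbf{H}(\mathbf{x})}<0$. Then $\mathbf{x}$ is exponentially unstable: it has a real multiplier $\rho>1$.
   Context: The billiard is the discrete Lagrangian system on $M$ ($\dim M=m$) with Lagrangian $L(x,y)=|x-y|$: the locally defined map $T(x,y)=(y,z)$, where $z\in M$ is determined by $\partial_y\bigl(L(x,y)+L(y,z)\bigr)=0$ (derivative along $M$). An $n$-periodic trajectory is a sequence $(x_i)$ in $M$, $x_{i+n}=x_i$, $x_i\neq x_{i+1}$, such that $\mathbf{x}=(x_1,\dots,x_n)$ is a critical point of the length functional $\mathscr{A}(\mathbf{x})=\sum_{i=1}^n|x_i-x_{i+1}|$ ($x_{n+1}=x_1$) on $M^n$. It is assumed, as always for discrete Lagrangian systems (twist condition), that the mixed second derivative $\partial_x\partial_yL$ is nondegenerate at $(x_i,x_{i+1})$, i.e. the segments $[x_i,x_{i+1}]$ are transversal to $M$ at their end points. $\mathbf{H}(\mathbf{x})$ is the Hessian of $\mathscr{A}$ at $\mathbf{x}$, and $\operatorname{ind}\mathbf{H}(\mathbf{x})$ is its Morse index. Multipliers are the eigenvalues of the linear Poincaré map $P=D(T^n)(x_1,x_2)$.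
   Formalization: The Hessian H(x) is additionally assumed nondegenerate; without this the claim fails, e.g. for the 2-periodic trajectory between two flat parallel pieces of a smoothed stadium (m=1, n=2, ind=0), whose only multiplier is 1. *)

(* Defs.v *)
From HB Require Import structures.
From mathcomp Require Import all_boot all_order all_algebra.
From mathcomp Require Import all_classical all_reals all_analysis.

Set Implicit Arguments.
Unset Strict Implicit.
Unset Printing Implicit Defensive.

Import Order.TTheory GRing.Theory Num.Theory.
Import numFieldNormedType.Exports.

Local Open Scope classical_set_scope.
Local Open Scope ring_scope.

(* The ambient space R^{m+1} is 'rV[R]_(1 + m).  The library norm on matrices
   is the sup norm (it only provides the topology here), so the Euclidean
   distance, which is the Lagrangian L(x, y) = |x - y|, is spelled out. *)
Definition lagr (R : realType) (d : nat) (x y : 'rV[R]_d) : R :=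
  Num.sqrt (\sum_(i < d) (x 0 i - y 0 i) ^+ 2).

Fixpoint Ck (R : realType) (m k : nat) (g : 'rV[R]_m -> R) : Prop :=
  match k with
  | 0%N => continuous g
  | k'.+1 => forall j : 'I_m,
      (forall u, derivable g u (delta_mx 0 j)) /\
      Ck k' (fun u => 'D_(delta_mx 0 j) g u)
  end.

Definition smooth (R : realType) (m : nat) (g : 'rV[R]_m -> R) : Prop :=
  forall k, Ck k g.

(* A hypersurface is presented locally as the graph of a smooth function in
   suitable orthonormal coordinates: [param c u] is the point of height
   [height c u] above u, and [graph_coord c] is the projection along the height axis,
   so that u |-> [param c u] is a local parametrization of the hypersurface
   with inverse [graph_coord c]. *)
Record graph_chart (R : realType) (m : nat) := GraphChart {
  frame : 'M[R]_(1 + m);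
  height : 'rV[R]_m -> R
}.

Section Charts.
Variables (R : realType) (m : nat).
Implicit Types (c : graph_chart R m) (p q : 'rV[R]_(1 + m)).

Definition param c (u : 'rV[R]_m) : 'rV[R]_(1 + m) :=
  row_mx (height c u)%:M u *m frame c.

Definition graph_coord c q : 'rV[R]_m := rsubmx (q *m (frame c)^T).

Definition level c q : R := lsubmx (q *m (frame c)^T) 0 0.

(* c is a boundary chart of D at p: near p, the set D is the part of the space
   lying strictly above the graph; hence near p the boundary of D is the graph *)
Definition chart_at (D : set 'rV[R]_(1 + m)) p c : Prop :=
  [/\ frame c *m (frame c)^T = 1%:M,
      smooth (height c) &
      \forall q \near p, D q <-> height c (graph_coord c q) < level c q].

Definition boundary (D : set 'rV[R]_(1 + m)) : set 'rV[R]_(1 + m) :=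
  closure D `\` interior D.

Definition smooth_boundary (D : set 'rV[R]_(1 + m)) : Prop :=
  forall p, boundary D p -> exists c, chart_at D p c.

Definition smooth_convex_domain (D : set 'rV[R]_(1 + m)) : Prop :=
  [/\ open D, D !=set0,
      convex_set (D : set (convex_lmodType 'rV[R]_(1 + m))) &
      smooth_boundary D].

End Charts.

Section Forms.
Variables (R : realType) (E : vectType R).

Definition nondegenerate_form (h : E -> E -> R) : Prop :=
  forall v, (forall w, h v w = 0) -> v = 0.

(* largest dimension of a subspace on which h is negative definite *)
Definition morse_index (h : E -> E -> R) : nat :=
  \max_(k < (\dim {: E}).+1 |
        `[< exists W : {vspace E}, \dim W = k /\
              forall v, v \in W -> v != 0 -> h v v < 0 >]) k.

End Forms.

Section Billiard.
Variables (R : realType) (m : nat) (D : set 'rV[R]_(1 + m)).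
Notation pt := 'rV[R]_(1 + m).

(* d/dy (L(x,y) + L(y,z)) = 0 along the boundary of D, in local coordinates *)
Definition reflection (x y z : pt) : Prop :=
  exists2 c, chart_at D y c &
    forall v : 'rV[R]_m,
      is_derive (graph_coord c y) v
        (fun u => lagr x (param c u) + lagr (param c u) z) 0.

(* z is picked among the points of the boundary satisfying the equation.  For
   x, y on the boundary of a convex D with the segment [x, y] transversal to
   the boundary at y there is at most one such z: its direction from y must be
   the mirror image of that of y - x, the outgoing ray meets the boundary at
   most once after y, and the unreflected ray does not meet it.  The value y is
   a dummy, used when no such z exists. *)
Definition next_point (x y : pt) : pt :=
  xget y [set z | [/\ boundary D z, z <> y & reflection x y z]].

Definition billiard_map (q : pt * pt) : pt * pt :=
  (q.2, next_point q.1 q.2).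

(* T^n read in the product of the charts c, c' of the boundary *)
Definition local_iter (n : nat) (c c' : graph_chart R m)
    (w : 'rV[R]_(m + m)) : 'rV[R]_(m + m) :=
  let q := iter n billiard_map (param c (lsubmx w), param c' (rsubmx w)) in
  row_mx (graph_coord c q.1) (graph_coord c' q.2).

(* rho is an eigenvalue of D(T^n)(x, y) *)
Definition multiplier (n : nat) (c c' : graph_chart R m) (x y : pt)
    (rho : R) : Prop :=
  let w := row_mx (graph_coord c x) (graph_coord c' y) in
  differentiable (local_iter n c c') w /\
  eigenvalue ('J (local_iter n c c') w) rho.

(* d_x d_y L is nondegenerate at (x, y) *)
Definition twist (x y : pt) : Prop :=
  forall c c', chart_at D x c -> chart_at D y c' ->
    nondegenerate_form (fun v w : 'rV[R]_m =>
      'D_v (fun u => 'D_w (fun u' => lagr (param c u) (param c' u'))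
                       (graph_coord c' y)) (graph_coord c x)).

(* The sequence (x_1, x_2, ...) of the trajectory is indexed from 0; on 'I_n, ordS is the cyclic
   successor. *)
Definition length_functional (n : nat) (y : 'I_n -> pt) : R :=
  \sum_(i < n) lagr (y i) (y (ordS i)).

(* Local coordinates on the n-th power of the boundary are the n x m matrices
   whose i-th row is the coordinate of the i-th point in the chart c i. *)
Definition local_length (n : nat) (c : nat -> graph_chart R m)
    (U : 'M[R]_(n, m)) : R :=
  length_functional (fun i : 'I_n => param (c i) (row i U)).

Definition coords_along (n : nat) (c : nat -> graph_chart R m) (x : nat -> pt)
    : 'M[R]_(n, m) :=
  \matrix_(i < n) graph_coord (c i) (x i).

Definition charts_along (x : nat -> pt) (c : nat -> graph_chart R m) : Prop :=
  forall i, chart_at D (x i) (c i).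

Definition hessian (n : nat) (c : nat -> graph_chart R m) (x : nat -> pt)
    (V W : 'M[R]_(n, m)) : R :=
  'D_V (fun U => 'D_W (@local_length n c) U) (coords_along n c x).

Definition periodic_trajectory (n : nat) (x : nat -> pt) : Prop :=
  [/\ forall i, x (i + n)%N = x i,
      forall i, boundary D (x i),
      forall i, x i <> x i.+1,
      forall c, charts_along x c ->
        forall V, is_derive (coords_along n c x) V (@local_length n c) 0 &
      forall i, twist (x i) (x i.+1)].

End Billiard.

(* Main.v *)
From HB Require Import structures.
Require Import Defs.
From mathcomp Require Import all_boot all_order all_algebra.
From mathcomp Require Import all_fingroup mxtens.
From mathcomp Require Import all_classical all_reals all_analysis.
From mathcomp Require Import ring lra zify.
Set Implicit Arguments.
Unset Strict Implicit.
Unset Printing Implicit Defensive.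
Import Order.TTheory GRing.Theory Num.Theory.
Import numFieldNormedType.Exports.
Local Open Scope classical_set_scope.
Local Open Scope ring_scope.

(** Write [u_i] for the coordinates of [x_i] in its chart and [B_i] for the mixed
    second derivative of the distance at [(x_i, x_(i+1))], an [m x m] matrix that
    the twist condition makes invertible.  A tangent vector to the space of
    trajectories is a sequence [v] solving the linearized equation
    [v_(i-1) P_i + v_i A_i + v_(i+1) B_i = 0], whose coefficients are the blocks
    of the Hessian, and the derivative of the [n]-th iterate of the billiard map
    sends [(v_0, v_1)] to [(v_n, v_(n+1))].  A real multiplier [rho] is therefore
    the same as a nonzero solution with [v_(i+n) = rho v_i].

    Put [s = 1 / rho] and take [v_1, ..., v_n] as unknowns, with [v_0 = s v_n] and
    [v_(-1) = s v_(n-1)].  The solutions are the kernel of a matrix [K_s] that is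
    affine in [s].  At [s = 1] it is the Hessian with its block rows shifted
    cyclically, so [det K_1 = (-1)^(m (n-1)) det H], and [det H] has the sign
    [(-1)^ind] because a maximal negative subspace and its H-orthogonal complement
    split [H] into a negative and a nonnegative block
    ([det_sign_negative_index]).  At [s = 0] it is block triangular, so
    [det K_0] is the product of the [det B_i].  If the two determinants have
    opposite signs, the intermediate value theorem gives [s] in [(0, 1)] with
    [det K_s = 0], hence [rho > 1] ([unstable_solution]).

    Convexity enters through the sign of [det B_i].  A Schur complement gives
    [det B_i = (-1 / l)^m <e, N_i> <e, N_(i+1)> det F_i det F_(i+1)], where [l] is
    the distance, [e] the unit vector from [x_(i+1)] to [x_i], the [N] are inner
    normals and the [F] the frames of the charts ([det_mixedL]).  The segment
    enters the domain at both ends, so [<e, N_i> < 0 < <e, N_(i+1)>]; the frame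
    determinants appear twice around the cycle, and the product of the [det B_i]
    has the sign [(-1)^(n (m+1))] ([det_steps_sign]).

    The billiard map is given by a choice of the next point, so its
    differentiability has to be proved.  The reflection law forces the direction
    of the next segment, and a ray entering a convex domain meets the boundary
    once more at most, so the next point is unique ([next_point_unique]).  Near
    the trajectory the intermediate value theorem along the reflected ray shows
    that it exists and lies close to the next point of the trajectory
    ([next_point_near]).  A continuous solution of a differentiable equation with
    invertible partial derivative is differentiable
    ([implicit_differentiable]), which yields both the derivative of the map and
    the linearized equation above ([step_coord_differentiable]).  The symmetry of
    the Hessian is Young's theorem on second derivatives ([derive_commute]). *)

(** * Determinants and the negative index of symmetric matrices *)

(** On a segment of matrices the determinant is a polynomial in the parameter, so
    the intermediate value theorem for polynomials applies. *)
Lemma det_segment_root (R : rcfType) N (A B : 'M[R]_N) :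
  \det A * \det B < 0 ->
  exists2 s : R, 0 < s < 1 & \det (A + s *: (B - A)) = 0.
Proof.
move=> AB.
pose M : 'M[{poly R}]_N := map_mx polyC A + 'X *: map_mx polyC (B - A).
have ME s : (\det M).[s] = \det (A + s *: (B - A)).
  rewrite -[_.[s]]/(horner_eval s (\det M)) -det_map_mx; congr (\det _).
  by apply/matrixP => i j; rewrite !mxE /= !horner_evalE !hornerE.
have E0 : (\det M).[0] = \det A by rewrite ME scale0r addr0.
have E1 : (\det M).[1] = \det B by rewrite ME scale1r addrC subrK.
have [s s01 /rootP rs] : exists2 s : R, s \in `[0, 1] & root (\det M) s.
  have [lA|lA] := ltP (\det A) 0.
    apply: poly_ivt => //; rewrite ?ler01// E0 E1 (ltW lA) /=.
    by move: AB; rewrite nmulr_rlt0// => /ltW.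
  have [s s01 rs] : exists2 s : R, s \in `[0, 1] & root (- \det M) s.
    apply: poly_ivt; rewrite ?ler01// ?hornerN E0 E1 oppr_le0 lA /= oppr_ge0.
    by rewrite leNgt; apply/negP => lB; move: AB; rewrite ltNge mulr_ge0// ltW.
  by exists s; rewrite // -rootN.
exists s; last by rewrite -ME.
move: s01; rewrite in_itv /= !le_eqVlt => /andP[/orP[/eqP s0|->] /orP[/eqP s1|->]] //.
- by move: rs AB; rewrite -s0 E0 => ->; rewrite mul0r ltxx.
- by move: rs AB; rewrite -s0 E0 => ->; rewrite mul0r ltxx.
- by move: rs AB; rewrite s1 E1 => ->; rewrite mulr0 ltxx.
Qed.

Lemma mulmx_trmx_ge0 (R : realDomainType) N (u : 'rV[R]_N) :
  0 <= (u *m u^T) 0 0.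
Proof.
by rewrite mxE; apply: sumr_ge0 => i _; rewrite mxE -expr2 sqr_ge0.
Qed.

Lemma mulmx_trmx_eq0 (R : realDomainType) N (u : 'rV[R]_N) :
  (u *m u^T) 0 0 = 0 -> u = 0.
Proof.
have sq i : u 0 i * u^T i 0 = u 0 i ^+ 2 by rewrite mxE.
rewrite mxE (eq_bigr _ (fun i _ => sq i)) => /psumr_eq0P u0.
apply/rowP => i; rewrite [RHS]mxE; apply/eqP; rewrite -sqrf_eq0; apply/eqP.
by apply: u0 => // j _; rewrite sqr_ge0.
Qed.

(** If the determinant were negative, a convex combination of the matrix with the
    identity would be singular, although it is positive definite. *)
Lemma det_psd_ge0 (R : rcfType) N (M : 'M[R]_N) :
  (forall u : 'rV_N, 0 <= (u *m M *m u^T) 0 0) -> 0 <= \det M.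
Proof.
move=> M0; rewrite leNgt; apply/negP => dM.
have [|s /andP[s0 s1] /eqP/det0P[u u0]] := @det_segment_root R N 1%:M M.
  by rewrite det1 mul1r.
move=> /(congr1 (fun v => (v *m u^T) 0 0)); rewrite mul0mx [RHS]mxE.
rewrite mulmxDr mulmx1 -scalemxAr mulmxBr mulmx1 mulmxDl -scalemxAl mulmxBl.
rewrite !mxE => eq0.
have : (u *m u^T) 0 0 = 0.
  have u1 := mulmx_trmx_ge0 u; have u2 := M0 u.
  have u3 : (1 - s) * (u *m u^T) 0 0 + s * (u *m M *m u^T) 0 0 = 0.
    by rewrite -[RHS]eq0 !mxE; ring.
  have h2 : 0 <= s * (u *m M *m u^T) 0 0 by apply: mulr_ge0 => //; exact: ltW.
  have h1 : 0 <= (1 - s) * (u *m u^T) 0 0 by apply: mulr_ge0 => //; lra.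
  have /eqP : (1 - s) * (u *m u^T) 0 0 = 0 by lra.
  by rewrite mulf_eq0 => /orP[|/eqP//]; rewrite subr_eq0 gt_eqF.
by move/mulmx_trmx_eq0/eqP; rewrite (negbTE u0).
Qed.

Lemma det_congruence (R : realFieldType) q N (qN : q = N) (H : 'M[R]_N)
    (Q : 'M[R]_(q, N)) :
  row_free Q -> exists2 d, 0 < d & \det (Q *m H *m Q^T) = d * \det H.
Proof.
subst q; rewrite row_free_unit unitmxE unitfE => dQ.
exists (\det Q ^+ 2); first by rewrite exprn_even_gt0.
by rewrite !det_mulmx det_tr; ring.
Qed.

(** The sign of the determinant of a symmetric matrix, read on a negative definite
    subspace of maximal dimension, spanned by the rows of [W]. *)
Lemma det_sign_negative_index (R : rcfType) N k (H : 'M[R]_N) (W : 'M[R]_(k, N)) :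
  H^T = H -> \det H != 0 ->
  (forall u : 'rV_k, u != 0 -> (u *m W *m H *m (u *m W)^T) 0 0 < 0) ->
  (forall k' (W' : 'M[R]_(k', N)),
     (forall u : 'rV_k', u != 0 -> (u *m W' *m H *m (u *m W')^T) 0 0 < 0) ->
     (k' <= k)%N) ->
  0 < (-1) ^+ k * \det H.
Proof.
move=> Hs dH negW maxW.
(* The H-orthogonal complement of W: by maximality H is nonnegative there. *)
pose Z := kermx (H *m W^T).
have dimZ : (k + (N - k) <= k + \rank Z)%N.
  rewrite leq_add2l mxrank_ker leq_sub2l //.
  by apply: leq_trans (rank_leq_col _) _.
have freeW : row_free W.
  apply/row_freeP; apply/row_freeP/inj_row_free => u uW.
  apply/eqP; case: eqP => // /eqP /negW; rewrite uW !mul0mx mxE ltxx //.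
have kN : (k <= N)%N by move: freeW; rewrite -row_leq_rank => /leq_trans; apply; exact: rank_leq_col.
have dimZ' : (N - k <= \rank Z)%N by rewrite leq_add2l in dimZ.
pose ZZ : 'M[R]_(N - k, N) := rowsub (widen_ord dimZ') (row_base Z).
have ZZ0 : ZZ *m H *m W^T = 0.
  apply/row_matrixP => i; rewrite row0 -mulmxA row_mul /ZZ row_rowsub -row_mul.
  suff -> : row_base Z *m (H *m W^T) = 0 by rewrite row0.
  by apply/sub_kermxP; rewrite eq_row_base.
have freeZ : row_free ZZ.
  have /row_freeP[Zi Zi1] := row_base_free Z.
  apply/row_freeP; exists (colsub (widen_ord dimZ') Zi).
  rewrite mulmx_colsub mul_rowsub_mx Zi1.
  by apply/matrixP => i j; rewrite !mxE.
have WZ0 : W *m H *m ZZ^T = 0.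
  by apply: trmx_inj; rewrite !trmx_mul trmxK Hs mulmxA ZZ0 trmx0.
pose Q : 'M[R]_(k + (N - k), N) := col_mx W ZZ.
have QHQ : Q *m H *m Q^T = block_mx (W *m H *m W^T) 0 0 (ZZ *m H *m ZZ^T).
  by rewrite /Q mul_col_mx tr_col_mx mul_col_row WZ0 ZZ0.
have psdZ (u : 'rV_(N - k)) : 0 <= (u *m (ZZ *m H *m ZZ^T) *m u^T) 0 0.
  rewrite leNgt; apply/negP => uneg.
  suff : (k + 1 <= k)%N by rewrite addn1 ltnn.
  apply: (maxW _ (col_mx W (u *m ZZ))) => v; rewrite -[v]hsubmxK.
  set v1 := lsubmx v; set v2 := rsubmx v => v0.
  rewrite mul_row_col [v2]mx11_scalar mul_scalar_mx.
  set a := v2 0 0.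
  have -> : ((v1 *m W + a *: (u *m ZZ)) *m H *m (v1 *m W + a *: (u *m ZZ))^T) 0 0
      = (v1 *m W *m H *m (v1 *m W)^T) 0 0
        + a ^+ 2 * (u *m (ZZ *m H *m ZZ^T) *m u^T) 0 0.
    rewrite raddfD /= !mulmxDl !mulmxDr.
    have -> : v1 *m W *m H *m (a *: (u *m ZZ))^T = 0.
      by rewrite linearZ /= -scalemxAr trmx_mul mulmxA -!(mulmxA v1) WZ0 !(mulmx0, mul0mx) scaler0.
    have -> : a *: (u *m ZZ) *m H *m (v1 *m W)^T = 0.
      by rewrite -!scalemxAl trmx_mul mulmxA -!(mulmxA u) ZZ0 !(mulmx0, mul0mx) scaler0.
    rewrite addr0 add0r mxE linearZ /= -!scalemxAl -!scalemxAr scalerA -expr2 [X in _ + X]mxE.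
    by rewrite !trmx_mul !mulmxA.
  have [v10|v10] := eqVneq v1 0.
    rewrite v10 !mul0mx mxE add0r pmulr_rlt0// exprn_even_gt0//= .
    apply: contra v0 => /eqP a0.
    by rewrite v10 [v2]mx11_scalar -/a a0 raddf0 row_mx0.
  by rewrite ltr_wnDr ?negW// nmulr_lle0 ?sqr_ge0.
have nsdW : 0 <= (-1) ^+ k * \det (W *m H *m W^T).
  rewrite -detZ scaleN1r; apply: det_psd_ge0 => u.
  rewrite mulmxN mulNmx mxE oppr_ge0.
  have [->|u0] := eqVneq u 0; first by rewrite !mul0mx mxE.
  by have := negW u u0; rewrite !trmx_mul !mulmxA => /ltW.
have freeQ : row_free Q.
  apply: inj_row_free => v; rewrite -[v]hsubmxK mul_row_col => vQ.
  have v10 : lsubmx v = 0.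
    apply/eqP; apply: contraT => /negW.
    rewrite {1}(canRL (addrK _) vQ) sub0r !mulNmx trmx_mul mulmxA.
    by rewrite -!(mulmxA (rsubmx v)) ZZ0 !(mulmx0, mul0mx) oppr0 mxE ltxx.
  move: vQ; rewrite v10 mul0mx add0r -(mul0mx _ ZZ) => /(row_free_inj freeZ) ->.
  by rewrite row_mx0.
have [d d0] := det_congruence (subnKC kN) H freeQ.
rewrite QHQ det_ublock => dE.
rewrite lt_def mulf_neq0 ?signr_eq0//= -(pmulr_rge0 _ d0) mulrCA -dE mulrA.
by rewrite mulr_ge0// det_psd_ge0.
Qed.

(** * Block matrices *)

Section Blocks.
Variables (R : comNzRingType).

(** The [n x n] block matrix with [m x m] blocks [F i j], acting on row vectors; the
    entry [a] of block [i] has index [i * m + a]. *)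
Definition blockmx n m (F : 'I_n -> 'I_n -> 'M[R]_m) : 'M[R]_(n * m) :=
  \matrix_(k, l) F (mxtens_unindex k).1 (mxtens_unindex l).1
                   (mxtens_unindex k).2 (mxtens_unindex l).2.

(** The rows of [U] put end to end, in the indexing of [blockmx]. *)
Definition flatten_mx n m (U : 'M[R]_(n, m)) : 'rV[R]_(n * m) :=
  \row_k U (mxtens_unindex k).1 (mxtens_unindex k).2.

Definition unflatten_mx n m (u : 'rV[R]_(n * m)) : 'M[R]_(n, m) :=
  \matrix_(i, a) u 0 (mxtens_index (i, a)).

Lemma flatten_mxK n m : cancel (@flatten_mx n m) (@unflatten_mx n m).
Proof. by move=> U; apply/matrixP => i a; rewrite !mxE mxtens_indexK. Qed.

Lemma unflatten_mxK n m : cancel (@unflatten_mx n m) (@flatten_mx n m).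
Proof.
move=> u; apply/rowP => k; rewrite !mxE -surjective_pairing.
by rewrite mxtens_unindexK.
Qed.

Lemma mxtens_index_lift n m (i : 'I_n) (a : 'I_m) :
  mxtens_index (lift ord0 i, a) = rshift m (mxtens_index (i, a)) :> 'I_(n.+1 * m).
Proof. by apply/val_inj => /=; rewrite /bump /= mulSn addnA. Qed.

Lemma mxtens_index0 n m (a : 'I_m) :
  mxtens_index (ord0, a) = lshift (n * m) a :> 'I_(n.+1 * m).
Proof. exact/val_inj. Qed.

Lemma mxtens_unindex_rshift n m (k : 'I_(n * m)) :
  mxtens_unindex (rshift m k : 'I_(n.+1 * m)) =
  (lift ord0 (mxtens_unindex k).1, (mxtens_unindex k).2).
Proof.
rewrite -[in LHS](mxtens_unindexK k) [mxtens_unindex k in LHS]surjective_pairing.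
by rewrite -mxtens_index_lift mxtens_indexK.
Qed.

Lemma mxtens_unindex_lshift n m (a : 'I_m) :
  mxtens_unindex (lshift (n * m) a : 'I_(n.+1 * m)) = (ord0, a).
Proof. by rewrite -mxtens_index0 mxtens_indexK. Qed.

Lemma sum_mxtens n m (f : 'I_(n * m) -> R) :
  \sum_k f k = \sum_i \sum_a f (mxtens_index (i, a)).
Proof.
rewrite pair_big /= (reindex (@mxtens_index n m)) /=; last first.
  by exists (@mxtens_unindex n m) => i _; rewrite (mxtens_indexK, mxtens_unindexK).
by apply: eq_bigr => -[].
Qed.

Lemma mul_flatten_blockmx n m (U : 'M[R]_(n, m)) F :
  flatten_mx U *m blockmx F =
  flatten_mx (\matrix_i (\sum_j row j U *m F j i)).
Proof.
apply/rowP => l; rewrite !mxE sum_mxtens summxE; apply: eq_bigr => j _.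
by rewrite mxE; apply: eq_bigr => a _; rewrite !mxE mxtens_indexK.
Qed.

Lemma mul_flatten_tr n m (U V : 'M[R]_(n, m)) :
  (flatten_mx U *m (flatten_mx V)^T) 0 0 =
  \sum_i (row i U *m (row i V)^T) 0 0.
Proof.
rewrite mxE sum_mxtens; apply: eq_bigr => i _; rewrite mxE.
by apply: eq_bigr => a _; rewrite !mxE !mxtens_indexK.
Qed.

Lemma det_blockmx_trig n m (F : 'I_n -> 'I_n -> 'M[R]_m) :
  (forall j i : 'I_n, (i < j)%N -> F j i = 0) ->
  \det (blockmx F) = \prod_i \det (F i i).
Proof.
elim: n F => [|n IHn] F F0; first by rewrite big_ord0 det_mx00.
rewrite big_ord_recl -(IHn (fun j i => F (lift ord0 j) (lift ord0 i))); last first.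
  by move=> j i ij; apply: F0; rewrite /= /bump.
have -> : blockmx F = block_mx (F ord0 ord0)
    (\matrix_(a, k) F ord0 (lift ord0 (mxtens_unindex k).1) a (mxtens_unindex k).2)
    0 (blockmx (fun j i => F (lift ord0 j) (lift ord0 i))) :> 'M[R]_(m + n * m).
  apply/matrixP => k l; rewrite mxE.
  case: (split_ordP k) => k' ->; case: (split_ordP l) => l' ->;
    rewrite ?block_mxEul ?block_mxEur ?block_mxEdl ?block_mxEdr;
    rewrite ?mxtens_unindex_lshift ?mxtens_unindex_rshift /= ?mxE //.
  by rewrite F0 // mxE.
by rewrite det_ublock.
Qed.

(** The cyclic shift of [N] elements is an [N]-cycle. *)
Lemma odd_ordS N : odd_perm (perm (@ordS_inj N)) = odd N.-1.
Proof.
case: N => [|N].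
  by rewrite (_ : perm _ = 1%g) ?odd_perm1//; apply/permP => -[].
have -> : perm (@ordS_inj N.+1) = lift_perm ord_max ord0 1.
  apply/permP => i; rewrite permE; apply/val_inj.
  case: (unliftP ord_max i) => [j ->|->].
    rewrite lift_perm_lift perm1 /= /bump leqNgt ltn_ord /= add0n add1n.
    by rewrite modn_small // ltnS.
  by rewrite lift_perm_id /= modnn.
by rewrite odd_lift_perm odd_perm1 /= !addbF.
Qed.

(** Shifting the block rows is the [m]-th power of the cyclic shift of all rows. *)
Lemma det_blockmx_ordS n m (F : 'I_n -> 'I_n -> 'M[R]_m) :
  \det (blockmx (fun k i => F (ordS k) i)) =
  (-1) ^+ (n.-1 * m) * \det (blockmx F).
Proof.
case: n F => [|n] F; first by rewrite !det_mx00 mulr1.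
case: m F => [|m] F; first by rewrite [(n.+1.-1 * 0)%N]muln0 mul1r; congr (\det _); apply/matrixP => -[k kn]; exfalso; rewrite muln0 in kn.
pose N := (n.+1 * m.+1)%N; pose s : 'S_N := perm (@ordS_inj N).
have sX k (i : 'I_N) : (s ^+ k)%g i = ((i + k) %% N)%N :> nat.
  elim: k => [|k IHk]; first by rewrite expg0 perm1 addn0 modn_small.
  rewrite expgSr permM permE /= IHk addnS.
  by have := modnDml (i + k) 1 N; rewrite !addn1.
have -> : blockmx (fun k i => F (ordS k) i) = row_perm (s ^+ m.+1)%g (blockmx F).
  apply/matrixP => k l; rewrite !mxE.
  suff -> : (s ^+ m.+1)%g k =
      mxtens_index (ordS (mxtens_unindex k).1, (mxtens_unindex k).2).
    by rewrite mxtens_indexK.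
  apply: ord_inj; rewrite sX /=.
  rewrite [in LHS](divn_eq k m.+1) addnAC -mulSnr.
  have r_lt : (k %% m.+1 < m.+1)%N by rewrite ltn_mod.
  have q_lt : (k %/ m.+1 < n.+1)%N by rewrite ltn_divLR.
  have [q_n|] := ltnP (k %/ m.+1).+1 n.+1.
    rewrite (modn_small q_n) modn_small //.
    by apply: leq_trans (leq_mul q_n (leqnn _)); rewrite [leqRHS]mulSnr -addnS leq_add2l.
  move=> n_q; have -> : (k %/ m.+1).+1 = n.+1 by apply/eqP; rewrite eqn_leq n_q q_lt.
  by rewrite modnn mul0n add0n modnDl modn_small // (leq_trans r_lt) // leq_pmull.
rewrite row_permE det_mulmx det_perm.
have -> : odd_perm (s ^+ m.+1)%g = odd (n.+1.-1 * m.+1) :> bool.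
  have -> k : odd_perm (s ^+ k)%g = odd k && odd_perm s.
    elim: k => [|k IHk]; first by rewrite expg0 odd_perm1.
    by rewrite expgS odd_permM IHk /=; case: (odd k); case: (odd_perm s).
  rewrite odd_ordS (_ : N.-1 = (m + n * m.+1)%N) // oddD !oddM /=.
  by case: (odd m); case: (odd n).
by rewrite signr_odd.
Qed.

End Blocks.

(** * Cyclic tridiagonal block systems *)

(** The contribution of [v_j] to the [i]-th equation
    [v_(i-1) P_i + v_i A_i + v_(i+1) B_i], indices being taken modulo [n].  The
    three terms are added because the cases overlap when [n <= 2]. *)
Definition cyclic_block (R : comNzRingType) n m (P A B : nat -> 'M[R]_m)
    (j i : 'I_n) : 'M[R]_m :=
  (if ordS j == i then P i else 0) + (if j == i then A i else 0)
  + (if j == ordS i then B i else 0).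

Lemma sum_cyclic_block (R : comNzRingType) n m (P A B : nat -> 'M[R]_m)
    (V : 'M[R]_(n, m)) (i : 'I_n) :
  \sum_j row j V *m cyclic_block P A B j i =
  row (ord_pred i) V *m P i + row i V *m A i + row (ordS i) V *m B i.
Proof.
have if0 (b : bool) (u : 'rV[R]_m) (M : 'M[R]_m) :
  u *m (if b then M else 0) = if b then u *m M else 0.
  by case: b; rewrite ?mulmx0.
under eq_bigr do rewrite !mulmxDr !if0.
rewrite !big_split /= -!big_mkcond /=.
rewrite (big_pred1 (ord_pred i)) ?big_pred1_eq // => j.
by rewrite -(can_eq (@ord_predK n)) ordSK.
Qed.

(** The unknowns are [v_1, ..., v_n], with [v_(k+1)] the row [k] of [V], and [v_0],
    [v_(-1)] stand for [s v_n], [s v_(n-1)]; these occur in the equations 0 and 1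
    only. *)
Lemma twisted_solution (R : rcfType) n m (P A B : nat -> 'M[R]_m) :
  (1 < n)%N ->
  (-1) ^+ (n.-1 * m) * \det (blockmx (@cyclic_block R n m P A B))
    * \prod_(i < n) \det (B i) < 0 ->
  exists2 s : R, 0 < s < 1 & exists2 V : 'M[R]_(n, m), V != 0 &
  forall i : 'I_n,
    (if (i <= 1)%N then s else 1) *: (row (ord_pred (ord_pred i)) V *m P i)
    + (if i == 0 :> nat then s else 1) *: (row (ord_pred i) V *m A i)
    + row i V *m B i = 0.
Proof.
move=> n1 neg.
(* G s k i is the contribution of v_(k+1) to the i-th equation. *)
pose G s (k i : 'I_n) :=
  (if ordS (ordS k) == i then (if (i <= 1)%N then s else 1) *: P i else 0)
  + (if ordS k == i then (if i == 0 :> nat then s else 1) *: A i else 0)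
  + (if k == i then B i else 0).
have G1 : \det (blockmx (G 1)) =
    (-1) ^+ (n.-1 * m) * \det (blockmx (@cyclic_block R n m P A B)).
  rewrite -det_blockmx_ordS; congr (\det _); apply/matrixP => k l.
  rewrite !mxE /G /cyclic_block !if_same !scale1r.
  by rewrite (inj_eq (@ordS_inj n)).
have ordSE (k : 'I_n) : (k.+1 < n)%N /\ ordS k = k.+1 :> nat \/ k.+1 = n /\ ordS k = 0%N :> nat.
  have := ltn_ord k; rewrite leq_eqVlt => /orP[/eqP kn|kn]; [right|left].
    by rewrite /= kn modnn.
  by rewrite /= modn_small.
have G0 : \det (blockmx (G 0)) = \prod_(i < n) \det (B i).
  rewrite det_blockmx_trig => [|j i ij].
    apply: eq_bigr => i _; congr (\det _); rewrite /G eqxx.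
    have -> : (ordS i == i) = false.
      by apply/negP => /eqP /(congr1 val) /=; have [[_ /= ->]|[+ /= ->]] := ordSE i; lia.
    case: eqP => [/(congr1 (@nat_of_ord n)) e|_]; last by rewrite !add0r.
    suff -> : (i <= 1)%N by rewrite scale0r !add0r.
    by have [[]|[]] := ordSE i; have [[]|[]] := ordSE (ordS i); lia.
  rewrite /G [j == i](_ : _ = false); last by apply/negP => /eqP e; move: ij; rewrite e ltnn.
  rewrite addr0.
  have -> : (if ordS j == i then (if i == 0 :> nat then 0 else 1) *: A i else 0) = 0.
    case: eqP => // /(congr1 (@nat_of_ord n)) e.
    suff -> : i = 0%N :> nat by rewrite scale0r.
    by have [[]|[]] := ordSE j; lia.
  case: eqP => [/(congr1 (@nat_of_ord n)) e|_]; last by rewrite addr0.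
  suff -> : (i <= 1)%N by rewrite scale0r addr0.
  by have [[]|[]] := ordSE j; have [[]|[]] := ordSE (ordS j); lia.
have [|s s01 /eqP /det0P[u u0 uG]] := @det_segment_root R _ (blockmx (G 0)) (blockmx (G 1)).
  by rewrite G0 G1 mulrC.
exists s => //; exists (unflatten_mx u).
  by apply: contra u0 => /eqP u0; rewrite -(unflatten_mxK u) u0; apply/eqP/rowP => k; rewrite !mxE.
have GE : blockmx (G 0) + s *: (blockmx (G 1) - blockmx (G 0)) = blockmx (G s).
  apply/matrixP => k l; rewrite !mxE /G.
  by do ![case: ifP => _]; rewrite !mxE; ring.
move: uG; rewrite GE -{1}(unflatten_mxK u) mul_flatten_blockmx => /(congr1 (@unflatten_mx _ _ _)).
rewrite flatten_mxK => VG i; move/(congr1 (row i)): VG; rewrite rowK.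
have -> : row i (@unflatten_mx R n m 0) = 0 by apply/rowP => k; rewrite !mxE.
move=> <-; rewrite /G; set V := unflatten_mx u.
have if0 (b : bool) (v : 'rV[R]_m) (M : 'M[R]_m) :
  v *m (if b then M else 0) = if b then v *m M else 0.
  by case: b; rewrite ?mulmx0.
under [RHS]eq_bigr do rewrite !mulmxDr !if0 -!scalemxAr.
rewrite !big_split /= -!big_mkcond /=.
rewrite (big_pred1 (ord_pred (ord_pred i))); last first.
  by move=> j; rewrite -(inj_eq (@ord_pred_inj n)) ordSK -(inj_eq (@ord_pred_inj n)) ordSK.
rewrite (big_pred1 (ord_pred i)) ?big_pred1_eq // => j.
by rewrite -(inj_eq (@ord_pred_inj n)) ordSK.
Qed.

(** The solution of [twisted_solution] extends to all indices by
    [v_(k+n) = v_k / s]. *)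
Lemma quasi_periodic_solution (R : rcfType) n m (P A B : nat -> 'M[R]_m) :
  (1 < n)%N ->
  (forall i, P (i + n)%N = P i) -> (forall i, A (i + n)%N = A i) ->
  (forall i, B (i + n)%N = B i) ->
  (-1) ^+ (n.-1 * m) * \det (blockmx (@cyclic_block R n m P A B))
    * \prod_(i < n) \det (B i) < 0 ->
  exists2 rho : R, 1 < rho & exists v : nat -> 'rV[R]_m,
    [/\ forall k, v (k + n)%N = rho *: v k,
        forall k, v k *m P k.+1 + v k.+1 *m A k.+1 + v k.+2 *m B k.+1 = 0 &
        exists k, v k != 0].
Proof.
move=> n1 Pn An Bn /twisted_solution[] // s /andP[s0 s1] [V V0 VE].
have n0 : (0 < n)%N by lia.
(* v k is s^(1 - q) times v_(r+1), where k + n - 1 = q n + r and r < n; the first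
   factor s accounts for v_0 = s v_n. *)
pose row' k : 'rV[R]_m := row (Ordinal (ltn_pmod k n0)) V.
have row'E (i : 'I_n) k : (k = i %[mod n])%N -> row' k = row i V.
  by move=> ki; congr (row _ V); apply: ord_inj; rewrite /= ki modn_small.
pose v k := (s * s^-1 ^+ ((k + n.-1) %/ n)) *: row' (k + n.-1)%N.
have per f q i : (forall i, f (i + n)%N = f i :> 'M[R]_m) -> f (q * n + i)%N = f i.
  by move=> fn; elim: q => [//|q <-]; rewrite mulSnr addnAC fn.
exists s^-1; first by rewrite invf_gt1.
exists v; split.
- move=> k; rewrite /v scalerA addnAC divnDr // divnn n0 addn1 exprS.
  rewrite mulrCA; congr (_ *: _); congr (row _ V); apply: ord_inj => /=.
  by rewrite modnDr.
- move=> k.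
  have [q [i kE]] : exists q, exists i : 'I_n, k.+1 = (q * n + i)%N.
    by exists (k.+1 %/ n)%N, (Ordinal (ltn_pmod k.+1 n0)); exact: divn_eq.
  have i_n := ltn_ord i.
  have predE (t : 'I_n) : ord_pred t = (if t == 0 :> nat then n.-1 else t.-1) :> nat.
    rewrite /=; case: eqP => t0; first by rewrite t0 modn_small //; lia.
    by rewrite (_ : (_ + n).-1 = t.-1 + n)%N ?modnDr ?modn_small //; have := ltn_ord t; lia.
  have [PE AE BE] : [/\ P k.+1 = P i, A k.+1 = A i & B k.+1 = B i].
    by rewrite kE !(per _ q i).
  have sK : s * s^-1 ^+ q.+1 * s = s * s^-1 ^+ q.
    by rewrite exprS -mulrA mulrAC mulVf ?mul1r ?gt_eqF.
  have vE j (r : nat) : (j + n.-1 = q * n + r)%N -> (r < n)%N ->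
      forall t : 'I_n, (r = t %[mod n])%N ->
      v j = (s * s^-1 ^+ q.+1) *: (s *: row t V).
    move=> jE rn t rt; rewrite scalerA sK /v jE divnMDl // divn_small // addn0.
    by congr (_ *: _); apply: row'E; rewrite modnMDl.
  have vE' j (r : nat) : (j + n.-1 = q.+1 * n + r)%N -> (r < n)%N ->
      forall t : 'I_n, (r = t %[mod n])%N ->
      v j = (s * s^-1 ^+ q.+1) *: row t V.
    move=> jE rn t rt; rewrite /v jE divnMDl // divn_small // addn0.
    by congr (_ *: _); apply: row'E; rewrite modnMDl.
  have e2 : v k.+2 = (s * s^-1 ^+ q.+1) *: row i V.
    by apply: (vE' _ i) => //; rewrite mulSn; lia.
  have e1 : v k.+1 = (s * s^-1 ^+ q.+1) *:
      ((if i == 0 :> nat then s else 1) *: row (ord_pred i) V).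
    have [i0|i0] := eqVneq (i : nat) 0%N.
      by apply: (vE _ n.-1); [lia|lia|rewrite predE i0].
    rewrite scale1r; apply: (vE' _ i.-1); rewrite ?mulSn; [lia|lia|].
    by rewrite predE (negbTE i0).
  have e0 : v k = (s * s^-1 ^+ q.+1) *:
      ((if (i <= 1)%N then s else 1) *: row (ord_pred (ord_pred i)) V).
    have [i1|i1] := leqP i 1.
      apply: (vE _ (i + n.-2)%N); first by lia.
        by lia.
      by congr modn; rewrite !predE; do 2![case: eqP => //]; lia.
    rewrite scale1r; apply: (vE' _ i.-2); rewrite ?mulSn; [lia|lia|].
    by congr modn; rewrite !predE; do 2![case: eqP => //]; lia.
  rewrite PE AE BE e0 e1 e2 -!scalemxAl -!scalerDr.
  by rewrite VE scaler0.
- have [k Vk] : exists k : 'I_n, row k V != 0.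
    apply/existsP; apply: contraNT V0; rewrite negb_exists => /forallP V0.
    by apply/eqP/row_matrixP => k; rewrite row0; apply/eqP; rewrite -[_ == _]negbK.
  exists k.+1; rewrite /v scaler_eq0 mulf_eq0 expf_eq0 invr_eq0 (gt_eqF s0) /= andbF /=.
  rewrite (_ : row' _ = row k V) //; apply: row'E.
  by rewrite (_ : k.+1 + n.-1 = k + n)%N ?modnDr //; lia.
Qed.

(** * The Morse index of a form given by a block matrix *)

Lemma morse_index_reached (R : realType) (E : vectType R) (h : E -> E -> R) :
  exists2 W : {vspace E}, \dim W = morse_index h &
    forall v, v \in W -> v != 0 -> h v v < 0.
Proof.
have [|k /asboolP[W [dW negW]] kE] := @eq_bigmax_cond _
    [pred k : 'I_(\dim {: E}).+1 | `[< exists W : {vspace E}, \dim W = k /\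
              forall v, v \in W -> v != 0 -> h v v < 0 >]] (fun k => k).
  apply/card_gt0P; exists ord0; apply/asboolP; exists 0%VS.
  by split=> [|v]; rewrite ?dimv0// memv0 => ->.
by exists W => //; rewrite dW -kE; apply: eq_bigl => i.
Qed.

Lemma morse_index_max (R : realType) (E : vectType R) (h : E -> E -> R)
    (W : {vspace E}) :
  (forall v, v \in W -> v != 0 -> h v v < 0) -> (\dim W <= morse_index h)%N.
Proof.
move=> negW; have dW : (\dim W < (\dim {: E}).+1)%N by rewrite ltnS dimvS ?subvf.
by apply: (@leq_bigmax_cond _ _ (fun k : 'I__ => k : nat) (Ordinal dW)); apply/asboolP; exists W.
Qed.

(** For a nondegenerate symmetric form the Morse index determines the sign of the
    determinant. *)
Lemma det_sign_morse_index (R : realType) n m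
    (h : 'M[R]_(n, m) -> 'M[R]_(n, m) -> R) (H : 'M[R]_(n * m)) :
  (forall V W, h V W = (flatten_mx V *m H *m (flatten_mx W)^T) 0 0) ->
  (forall V W, h V W = h W V) -> nondegenerate_form h ->
  0 < (-1) ^+ morse_index h * \det H.
Proof.
move=> hE hC hnd.
have Hs : H^T = H.
  apply/matrixP => k l; have := hC (unflatten_mx (delta_mx 0 l)) (unflatten_mx (delta_mx 0 k)).
  by rewrite !hE !unflatten_mxK -!rowE !trmx_delta -!colE !mxE.
have dH : \det H != 0.
  apply/det0P => -[u u0 uH]; case/eqP: u0.
  rewrite -(unflatten_mxK u) (hnd (unflatten_mx u)); first by apply/rowP => k; rewrite !mxE.
  by move=> W; rewrite hE unflatten_mxK uH mul0mx mxE.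
have [W dW negW] := morse_index_reached h.
pose WM : 'M[R]_(morse_index h, n * m) :=
  \matrix_(i < morse_index h) flatten_mx ((vbasis W)`_i).
have flatten_sum (u : 'rV[R]_(morse_index h)) :
    u *m WM = flatten_mx (\sum_(i < morse_index h) u 0 i *: (vbasis W)`_i).
  rewrite mulmx_sum_row; apply/rowP => k; rewrite !mxE !summxE.
  by apply: eq_bigr => i _; rewrite !mxE.
apply: (@det_sign_negative_index _ _ _ H WM) => // [u u0|k' W' negW'].
  rewrite flatten_sum -hE; apply: negW.
    apply: memv_suml => i _; apply: memvZ; apply: vbasis_mem.
    by rewrite mem_nth // size_tuple dW.
  apply: contra u0 => /eqP u0; apply/eqP/rowP => i; rewrite mxE.
  have : free (tcast dW (vbasis W)) by rewrite val_tcast (basis_free (vbasisP W)).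
  move/freeP => /(_ (fun i => u 0 i)); rewrite val_tcast; apply.
  by rewrite -[LHS]flatten_mxK u0; apply/matrixP => ? ?; rewrite !mxE.
pose f (u : 'rV[R]_k') := unflatten_mx (u *m W').
have flin : linear f.
  by move=> a u v; rewrite /f mulmxDl -scalemxAl; apply/matrixP => i j; rewrite !mxE.
pose fL := GRing.isLinear.Build R _ _ _ f flin.
pose F : {linear 'rV[R]_k' -> 'M[R]_(n, m)} := HB.pack f fL.
pose g := linfun F.
have gE u : g u = f u by rewrite lfunE.
have ginj : lker g == 0%VS.
  apply/lker0P => u v; rewrite !gE => /matrixP fuv.
  apply/eqP; rewrite -subr_eq0; apply: contraT => /negW'.
  rewrite (_ : (u - v) *m W' = 0) ?mul0mx ?mxE ?ltxx//.
  apply/rowP => k; rewrite -(mxtens_unindexK k) [_ k]surjective_pairing mulmxBl.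
  by have := fuv (mxtens_unindex k).1 (mxtens_unindex k).2; rewrite !mxE => ->; rewrite subrr.
have := morse_index_max (h := h) (W := limg g).
rewrite limg_dim_eq ?dimvf /dim /= ?mul1n; last by rewrite (eqP ginj) capv0.
apply => v /memv_imgP[u _ ->]; rewrite gE hE unflatten_mxK => fu.
by apply: negW'; apply: contra fu => /eqP ->; rewrite /f mul0mx; apply/eqP/matrixP => i j; rewrite !mxE.
Qed.

(** The linear algebra of the instability criterion: [h] is the form with the cyclic
    tridiagonal blocks [P_i], [A_i], [B_i]. *)
Lemma unstable_solution (R : realType) n m (P A B : nat -> 'M[R]_m)
    (h : 'M[R]_(n, m) -> 'M[R]_(n, m) -> R) :
  (1 < n)%N ->
  (forall i, P (i + n)%N = P i) -> (forall i, A (i + n)%N = A i) ->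
  (forall i, B (i + n)%N = B i) ->
  (forall V W, h V W = \sum_(i < n)
     ((row (ord_pred i) V *m P i + row i V *m A i + row (ordS i) V *m B i)
       *m (row i W)^T) 0 0) ->
  (forall V W, h V W = h W V) -> nondegenerate_form h ->
  (-1) ^+ (n.-1 * m + morse_index h) * \prod_(i < n) \det (B i) < 0 ->
  exists2 rho : R, 1 < rho & exists v : nat -> 'rV[R]_m,
    [/\ forall k, v (k + n)%N = rho *: v k,
        forall k, v k *m P k.+1 + v k.+1 *m A k.+1 + v k.+2 *m B k.+1 = 0 &
        exists k, v k != 0].
Proof.
move=> n1 Pn An Bn hE hC hnd sgn; apply: quasi_periodic_solution => //.
have hH V W : h V W = (flatten_mx V *m blockmx (@cyclic_block R n m P A B) *m (flatten_mx W)^T) 0 0.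
  rewrite hE mul_flatten_blockmx mul_flatten_tr; apply: eq_bigr => i _.
  by rewrite rowK sum_cyclic_block.
have := det_sign_morse_index hH hC hnd; set d := \det _ => d0.
rewrite -(pmulr_llt0 _ d0); move: sgn; rewrite exprD.
set a := (-1) ^+ morse_index h in d0 *; set p := \prod_(i < n) _; set b := (-1) ^+ _.
move=> sgn; have -> : b * d * p * (a * d) = b * a * p * d ^+ 2 by ring.
rewrite pmulr_llt0 // exprn_even_gt0 //=.
by apply: contraTneq d0 => ->; rewrite mulr0 ltxx.
Qed.

(** * Differential calculus with values in matrices *)

Section Eps.
Context {R : numFieldType} {V W : normedModType R}.

Lemma differentiable_eps (f : V -> W) x e : differentiable f x -> 0 < e ->
  \forall h \near 0, `|f (h + x) - f x - 'd f x h| <= e * `|h|.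
Proof.
move=> /diff_locally/eqaddoP fx e0; have := fx _ e0.
by apply: filterS => h; rewrite /= opprD addrA.
Qed.

(** Converse of [differentiable_eps]: an explicit linear approximation is the
    differential. *)
Lemma eps_differentiable (f : V -> W) (df : {linear V -> W}) x :
  continuous df ->
  (forall e, 0 < e -> \forall h \near 0, `|f (h + x) - f x - df h| <= e * `|h|) ->
  differentiable f x /\ 'd f x = df :> (V -> W).
Proof.
move=> cdf feps.
have fE : f \o shift x = cst (f x) + df +o_ 0 id.
  apply/eqaddoP => e e0; have := feps _ e0.
  by apply: filterS => h; rewrite /= opprD addrA.
have dE : 'd f x = df :> (V -> W) by exact: diff_unique.
by split => //; apply/diff_locallyP; rewrite dE.
Qed.

End Eps.

Section Matrix.
Context {R : realFieldType}.

Lemma differentiable_mxP {V : normedModType R} m n (M : V -> 'M[R]_(m, n)) t :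
  differentiable M t <-> forall i j, differentiable (fun x => M x i j) t.
Proof.
split=> [dM i j|dM].
  apply: (@differentiable_comp _ _ _ _ M (fun N : 'M[R]_(m, n) => N i j : R)) => //.
  exact: differentiable_coord.
rewrite (_ : M = \sum_(i < m) (\sum_(j < n) (fun x => M x i j *: delta_mx i j))).
  by apply: differentiable_sum => i; apply: differentiable_sum => j; exact: differentiableZl.
apply/funext => x; rewrite [LHS]matrix_sum_delta fct_sumE; apply: eq_bigr => i _.
by rewrite fct_sumE.
Qed.

Lemma linear_mx_differentiable {W : normedModType R} m n
    (f : {linear 'M[R]_(m, n) -> W}) x : differentiable f x.
Proof.
rewrite (_ : GRing.Linear.sort f = \sum_(i < m) (\sum_(j < n) (fun x : 'M[R]_(m, n) => x i j *: f (delta_mx i j)))).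
  apply: differentiable_sum => i; apply: differentiable_sum => j.
  by apply: differentiableZl; exact: differentiable_coord.
apply/funext => y; rewrite [in LHS](matrix_sum_delta y) linear_sum fct_sumE.
apply: eq_bigr => i _; rewrite linear_sum fct_sumE; apply: eq_bigr => j _.
by rewrite linearZ.
Qed.

Lemma linear_mx_continuous {W : normedModType R} m n
    (f : {linear 'M[R]_(m, n) -> W}) : continuous f.
Proof. by move=> x; exact/differentiable_continuous/linear_mx_differentiable. Qed.

Lemma derive_coord {V : normedModType R} m n (M : V -> 'M[R]_(m, n)) t v i j :
  derivable M t v -> 'D_v (fun x => M x i j) t = ('D_v M t) i j.
Proof. by move=> /derive_mx ->; rewrite mxE. Qed.

Lemma derivable_mulmx {V : normedModType R} m n p (A : V -> 'M[R]_(m, n))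
    (B : V -> 'M[R]_(n, p)) t v : derivable A t v -> derivable B t v ->
  is_derive t v (fun x => A x *m B x) ('D_v A t *m B t + A t *m 'D_v B t).
Proof.
move=> dA dB.
have dAe i j := (derivable_mxP A t v).1 dA i j.
have dBe i j := (derivable_mxP B t v).1 dB i j.
have dM i j : is_derive t v (fun x => (A x *m B x) i j)
    (('D_v A t *m B t + A t *m 'D_v B t) i j).
  have -> : (fun x => (A x *m B x) i j) = \sum_k ((fun x => A x i k) * (fun x => B x k j)).
    by apply/funext => x; rewrite mxE fct_sumE.
  rewrite mxE !mxE -big_split /=; apply: is_derive_sum => k.
  have h := @is_deriveM _ _ (fun x => A x i k) (fun x => B x k j) t v _ _
    (derivableP (dAe i k)) (derivableP (dBe k j)).
  apply: (is_derive_eq h).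
  by rewrite !derive_coord // /GRing.scale /=; ring.
have dAB : derivable (fun x => A x *m B x) t v by apply/derivable_mxP => i j.
apply: DeriveDef => //; rewrite derive_mx //; apply/matrixP => i j.
by rewrite mxE derive_val.
Qed.

Lemma differentiable_mulmx {V : normedModType R} m n p (A : V -> 'M[R]_(m, n))
    (B : V -> 'M[R]_(n, p)) t : differentiable A t -> differentiable B t ->
  differentiable (fun x => A x *m B x) t.
Proof.
move=> /differentiable_mxP dA /differentiable_mxP dB.
apply/differentiable_mxP => i j.
have -> : (fun x => (A x *m B x) i j) = \sum_k ((fun x => A x i k) * (fun x => B x k j)).
  by apply/funext => x; rewrite mxE fct_sumE.
by apply: differentiable_sum => k; exact: differentiableM.
Qed.

End Matrix.

(** * Mean value theorems, symmetry of second derivatives, implicit functions *)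

Lemma is_derive_line (R : numFieldType) (V W : normedModType R) (g : V -> W)
    (p v : V) (t : R) : derivable g (t *: v + p) v ->
  is_derive t 1 (fun s : R => g (s *: v + p)) ('D_v g (t *: v + p)).
Proof.
move=> dg.
have E : (fun h : R => h^-1 *: ((fun s => g (s *: v + p)) (h *: 1 + t) - g (t *: v + p)))
    = (fun h => h^-1 *: (g (h *: v + (t *: v + p)) - g (t *: v + p))).
  by apply/funext => h; rewrite [_ *: 1]mulr1 scalerDl addrA.
by apply: DeriveDef; [rewrite /derivable E|rewrite /derive E].
Qed.

(** The mean value theorem between 0 and [a], for [a] of either sign. *)
Lemma MVT_abs (R : realType) (f df : R -> R) (a : R) :
  (forall x : R, `|x| <= `|a| -> is_derive x 1 f (df x)) ->
  exists2 c, `|c| <= `|a| & f a - f 0 = df c * a.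
Proof.
move=> fd.
have cf x : `|x| <= `|a| -> {for x, continuous f}.
  move=> /fd dx; apply/differentiable_continuous/derivable1_diffP.
  by have [] := dx.
have [a0|a0|->] := ltgtP a 0.
- have [||c] := @MVT _ f df a 0 a0.
  + move=> x; rewrite in_itv /= => /andP[ax x0]; apply: fd.
    by rewrite !ltr0_norm// lerN2 ltW.
  + apply: continuous_in_subspaceT => x; rewrite inE /= in_itv /= => /andP[ax x0].
    by apply: cf; rewrite !ler0_norm// ?lerN2 // ltW.
  rewrite in_itv /= => /andP[ac c0] e; exists c.
    by rewrite !ltr0_norm// lerN2 ltW.
  by rewrite -[LHS]opprB e sub0r mulrN opprK.
- have [||c] := @MVT _ f df 0 a a0.
  + move=> x; rewrite in_itv /= => /andP[x0 xa]; apply: fd.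
    by rewrite !gtr0_norm// ltW.
  + apply: continuous_in_subspaceT => x; rewrite inE /= in_itv /= => /andP[x0 xa].
    by apply: cf; rewrite !ger0_norm// ltW.
  rewrite in_itv /= => /andP[c0 ca] e; exists c.
    by rewrite !gtr0_norm// ltW.
  by rewrite e subr0.
by exists 0; rewrite ?normr0// subrr mulr0.
Qed.

Section Partials.
Context {R : realType} {m : nat}.
Implicit Types (g : 'rV[R]_m -> R) (u v h : 'rV[R]_m).

(** [h] with the coordinates of index at least [k] replaced by 0. *)
Definition trunc_row h (k : nat) : 'rV[R]_m :=
  \row_j (if (j < k)%N then h 0 j else 0).

Lemma rV_norm_le h (e : R) : 0 <= e -> (forall j, `|h 0 j| <= e) -> `|h| <= e.
Proof.
move=> e0 he; rewrite /Num.Def.normr /= mx_normrE; apply: bigmax_le => // -[i j] _ /=.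
by rewrite ord1.
Qed.

Lemma rV_norm_ge h j : `|h 0 j| <= `|h|.
Proof.
rewrite [leRHS]/Num.Def.normr /= mx_normrE.
exact: (le_bigmax _ (fun i : 'I_1 * 'I_m => `|h i.1 i.2|) (0, j)).
Qed.

(** The increment is split along the truncations of [h] and the mean value theorem
    is applied to one coordinate at a time. *)
Lemma continuous_partials_differentiable g u :
  (forall j y, derivable g y (delta_mx 0 j)) ->
  (forall j, {for u, continuous (fun y => 'D_(delta_mx 0 j) g y)}) ->
  differentiable g u /\
  (forall v, 'd g u v = \sum_j v 0 j * 'D_(delta_mx 0 j) g u).
Proof.
move=> dg cg.
pose L v : R := \sum_j v 0 j * 'D_(delta_mx 0 j) g u.
have Llin : linear L.
  move=> a x y; rewrite /L scaler_sumr -big_split; apply: eq_bigr => j _ /=.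
  by rewrite !mxE mulrDl -mulrA.
pose LM := GRing.isLinear.Build R _ _ _ L Llin.
pose F : {linear 'rV[R]_m -> R} := HB.pack L LM.
suff [dgu dE] : differentiable g u /\ 'd g u = F :> ('rV[R]_m -> R).
  by split => // v; rewrite dE.
apply: eps_differentiable; first exact: linear_mx_continuous.
move=> e e0.
have em0 : 0 < e / m.+1%:R by rewrite divr_gt0.
have nearj j : \forall y \near u,
    `|'D_(delta_mx 0 j) g u - 'D_(delta_mx 0 j) g y| <= e / m.+1%:R.
  exact: ((cvgrPdist_le _ _).1 (cg j) _ em0).
have [d d0 du] := (nbhs_ballP _ _).1 (filter_forall _ nearj).
have nd : \forall h \near (0 : 'rV[R]_m), `|h| < d by apply: nbhs0_lt.
apply: filterS nd => h hd.
have step (k : 'I_m) :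
  `|g (trunc_row h k.+1 + u) - g (trunc_row h k + u) - h 0 k * 'D_(delta_mx 0 k) g u|
   <= e / m.+1%:R * `|h|.
  have [t|c ck] := @MVT_abs _ (fun s => g (s *: delta_mx 0 k + (trunc_row h k + u)))
      (fun s => 'D_(delta_mx 0 k) g (s *: delta_mx 0 k + (trunc_row h k + u))) (h 0 k).
    by move=> _; exact: (is_derive_line (dg k _)).
  rewrite scale0r add0r.
  have -> : h 0 k *: delta_mx 0 k + (trunc_row h k + u) = trunc_row h k.+1 + u.
    rewrite addrA; congr (_ + _); apply/rowP => j; rewrite !mxE eqxx /= ltnS.
    rewrite -val_eqE /=; case: ltngtP => // [jk|jk|/val_inj ->].
    - by rewrite mulr0 add0r.
    - by rewrite mulr0 add0r.
    - by rewrite mulr1 addr0.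
  move=> ->; rewrite mulrC -mulrBr normrM mulrC ler_pM// ?rV_norm_ge // distrC.
  apply: du; rewrite -ball_normE /= distrC addrA addrK.
  apply: le_lt_trans hd; apply: rV_norm_le => // j; rewrite !mxE eqxx /=.
  rewrite -val_eqE /=; case: ltngtP => // [jk|jk|_].
  - by rewrite mulr0 add0r rV_norm_ge.
  - by rewrite mulr0 add0r normr0.
  - by rewrite mulr1 addr0 (le_trans ck)// rV_norm_ge.
have tr0 : trunc_row h 0 = 0 by apply/rowP => j; rewrite !mxE.
have trm : trunc_row h m = h by apply/rowP => j; rewrite !mxE ltn_ord.
have -> : g (h + u) - g u = \sum_(k < m) (g (trunc_row h k.+1 + u) - g (trunc_row h k + u)).
  rewrite -(big_mkord xpredT (fun k => g (trunc_row h k.+1 + u) - g (trunc_row h k + u))).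
  by rewrite telescope_sumr // tr0 trm add0r.
rewrite /= /L -sumrB; apply: le_trans (ler_norm_sum _ _ _) _.
apply: le_trans (ler_sum _ (fun k _ => step k)) _.
rewrite sumr_const card_ord -mulrnAl ler_wpM2r // -mulr_natl mulrCA.
by rewrite ger_pMr // ler_pdivrMr // mul1r ler_nat.
Qed.

End Partials.

Section Young.
Context {R : realType} {V : normedModType R}.
Implicit Types (f : V -> R) (p A B : V).

(** The mixed second difference of [f] at [p] with increments [A] and [B]. *)
Definition second_difference f p A B : R :=
  f (B + (A + p)) - f (B + p) - (f (A + p) - f p).

Lemma second_differenceC f p A B :
  second_difference f p A B = second_difference f p B A.
Proof. by rewrite /second_difference addrCA; ring. Qed.

(** By the mean value theorem in the direction [A], the second difference is
    [t] times an increment of ['D_A f] in the direction [t B]. *)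
Lemma second_difference_eps f p A B (e : R) :
  (\forall q \near p, derivable f q A) -> differentiable ('D_A f) p ->
  0 < e ->
  \forall t \near (0 : R), `|second_difference f p (t *: A) (t *: B)
    - t ^+ 2 * 'D_B ('D_A f) p| <= e * t ^+ 2.
Proof.
move=> fA dfA e0.
pose C := `|A| + `|B| + 1.
have C0 : 0 < C by rewrite /C; apply: ltr_wpDl => //; rewrite addr_ge0.
have eC0 : 0 < e / (2 * C) by rewrite divr_gt0 // mulr_gt0.
have := differentiable_eps dfA eC0.
rewrite (near_shift 0 p) in fA.
move=> /(filterI fA) /nbhs_ballP[d d0 hd].
have dC0 : 0 < d / C by rewrite divr_gt0.
have nd : \forall t \near (0 : R), `|t| < d / C by apply: nbhs0_lt.
apply: filterS nd => t td.
have small (s r : R) : `|s| <= `|t| -> `|r| <= `|t| -> `|s *: A + r *: B| <= `|t| * C /\ ball 0 d (s *: A + r *: B).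
  move=> st rt.
  have le : `|s *: A + r *: B| <= `|t| * C.
    apply: le_trans (ler_normD _ _) _; rewrite !normrZ.
    apply: (@le_trans _ _ (`|t| * `|A| + `|t| * `|B|)).
      by apply: lerD; apply: ler_wpM2r.
    by rewrite -mulrDr ler_wpM2l // /C lerDl.
  split => //; rewrite -ball_normE /= sub0r normrN; apply: le_lt_trans le _.
  by rewrite -ltr_pdivlMr.
have small0 s : `|s| <= `|t| -> `|s *: A| <= `|t| * C /\ ball 0 d (s *: A).
  by move=> st; have := @small s 0 st; rewrite scale0r addr0 normr0; apply.
have [s|c ct E] := @MVT_abs _
   (fun s => f (s *: A + (t *: B + p)) - f (s *: A + p))
   (fun s => 'D_A f (s *: A + (t *: B + p)) - 'D_A f (s *: A + p)) t.
  move=> st; apply: is_deriveB; apply: is_derive_line.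
    have [_ /hd[]] := small s t st (lexx _).
    by rewrite /= subr0 addrA.
  have [_ /hd[]] := small0 s st.
  by rewrite /= subr0.
have -> : second_difference f p (t *: A) (t *: B) =
   ('D_A f (c *: A + (t *: B + p)) - 'D_A f (c *: A + p)) * t.
  by rewrite -E !scale0r !add0r /second_difference addrCA; ring.
have [b1 /hd[_ /= h1]] := small c t ct (lexx _).
have [b2 /hd[_ /= h2]] := small0 c ct.
rewrite [X in t ^+ 2 * X]deriveE //.
have dl : 'd ('D_A f) p (c *: A + t *: B) = 'd ('D_A f) p (c *: A) + t *: 'd ('D_A f) p B.
  by rewrite linearD [X in _ + X]linearZ.
move: h1 h2; rewrite dl -(addrA (c *: A)).
set P := 'D_A f (c *: A + (t *: B + p)); set Q := 'D_A f (c *: A + p); set Z := 'D_A f p.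
set u := 'd _ _ (c *: A); set w := 'd _ _ B => h1 h2.
have -> : (P - Q) * t - t ^+ 2 * w = ((P - Z - (u + t *: w)) - (Q - Z - u)) * t.
  by rewrite /GRing.scale /=; ring.
rewrite normrM.
have -> : e * t ^+ 2 = (e / (2 * C) * (`|t| * C) + e / (2 * C) * (`|t| * C)) * `|t|.
  rewrite -mulrDr -mulrA -mulrDl -[t ^+ 2]real_normK ?num_real //.
  by field; rewrite gt_eqF.
apply: ler_wpM2r => //; apply: le_trans (ler_normB _ _) _; apply: lerD.
  by apply: le_trans h1 _; rewrite ler_wpM2l // ltW.
by apply: le_trans h2 _; rewrite ler_wpM2l // ltW.
Qed.

(** Young's theorem: the second difference is symmetric in the two directions. *)
Lemma derive_commute f p A B :
  (\forall q \near p, derivable f q A) -> (\forall q \near p, derivable f q B) ->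
  differentiable ('D_A f) p -> differentiable ('D_B f) p ->
  'D_B ('D_A f) p = 'D_A ('D_B f) p.
Proof.
move=> fA fB dA dB; apply/eqP; rewrite -subr_eq0 -normr_le0.
apply/ler_addgt0Pl => e e0; rewrite addr0.
have e20 : 0 < e / 2 by rewrite divr_gt0.
have h1 := second_difference_eps B fA dA e20.
have h2 := second_difference_eps A fB dB e20.
have [d /= d0 hd] := (nbhs_ballP _ _).1 (filterI h1 h2).
have [] := hd (d / 2); first by rewrite -ball_normE /= sub0r normrN gtr0_norm; lra.
move=> k1; rewrite second_differenceC; move: k1.
set t := d / 2; set S := second_difference _ _ _ _; set X := 'D_B _ _; set Y := 'D_A _ _.
have t0 : 0 < t ^+ 2 by rewrite exprn_gt0 // divr_gt0.
move=> k1 k2; rewrite -(ler_pM2r t0) -(ger0_norm (ltW t0)) -normrM.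
have -> : (X - Y) * t ^+ 2 = (S - t ^+ 2 * Y) - (S - t ^+ 2 * X) by ring.
apply: le_trans (ler_normB _ _) _; rewrite (ger0_norm (ltW t0)).
by apply: le_trans (lerD k2 k1) _; rewrite -mulrDl -splitr.
Qed.

End Young.

Section Implicit.
Context {R : realType} {V : normedModType R} {b : nat}.

(** A continuous solution [F] of [E (q, F q) = 0] is differentiable where [E] is
    differentiable with invertible partial differential in the second variable. *)
Lemma implicit_differentiable (E : V * 'rV[R]_b -> 'rV[R]_b) (F : V -> 'rV[R]_b)
    (p : V) (M : 'M[R]_b) :
  differentiable E (p, F p) -> M \in unitmx ->
  (forall w, 'd E (p, F p) (0, w) = w *m M) ->
  {for p, continuous F} -> (\forall q \near p, E (q, F q) = 0) ->
  differentiable F p /\ (forall v, 'd E (p, F p) (v, 'd F p v) = 0).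
Proof.
move=> dE uM dM cF E0.
pose Minv : {linear 'rV[R]_b -> 'rV[R]_b} := mulmxr (invmx M).
pose L0 (v : V) : 'rV[R]_b := - (Minv ('d E (p, F p) (v, 0))).
have L0lin : linear L0.
  move=> a x y; rewrite /L0 (_ : (a *: x + y, 0) = a *: (x, 0) + (y, 0)); last first.
    by congr pair; rewrite /= scaler0 addr0.
  by rewrite (linearP ('d E (p, F p))) (linearP Minv) opprD scalerN.
pose LM := GRing.isLinear.Build R _ _ _ L0 L0lin.
pose L : {linear V -> 'rV[R]_b} := HB.pack L0 LM.
have cL : continuous L.
  move=> x; apply: (@continuous_comp _ _ _ (fun v : V => Minv ('d E (p, F p) (v, 0))) -%R); last exact: opp_continuous.
  apply: (@continuous_comp _ _ _ (fun v : V => 'd E (p, F p) (v, 0)) Minv).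
    apply: (@continuous_comp _ _ _ (fun v : V => (v, 0 : 'rV[R]_b)) ('d E (p, F p))).
      by apply: differentiable_continuous; apply: differentiable_pair.
    exact: diff_continuous.
  exact: linear_mx_continuous.
have Lprop v : 'd E (p, F p) (v, L v) = 0.
  rewrite (_ : (v, L v : 'rV_b) = (v, 0) + (0, L v)); last by congr pair; rewrite /= ?addr0 ?add0r.
  by rewrite linearD dM /= /L0 mulNmx mulmxKV // subrr.
suff [dF dFE] : differentiable F p /\ 'd F p = L :> (V -> 'rV[R]_b).
  by split => // v; rewrite dFE Lprop.
apply: eps_differentiable => // e e0.
have [C C0 hC] := linear_lipschitz (@linear_mx_continuous _ _ _ _ Minv).
have [K K0 hK] := linear_lipschitz cL.
pose eta := Num.min (1 / (2 * C)) (e / (C * (2 * K + 2))).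
have eta0 : 0 < eta.
  by rewrite lt_min !divr_gt0 // ?mulr_gt0 // addr_gt0 // mulr_gt0.
have CK0 : 0 < C * (2 * K + 2) by rewrite mulr_gt0 // addr_gt0 // mulr_gt0.
have eta1 : C * eta <= 1 / 2.
  rewrite mulrC -ler_pdivlMr // ge_min; apply/orP; left.
  by rewrite le_eqVlt; apply/orP; left; apply/eqP; field; rewrite gt_eqF.
have eta2 : C * eta * (2 * K + 2) <= e.
  by rewrite mulrAC mulrC -ler_pdivlMr // ge_min lexx orbT.
have [d /= d0 hd] := (nbhs_ballP _ _).1 (differentiable_eps dE eta0).
have cF' : \forall h \near (0 : V), `|F (h + p) - F p| < d.
  have nF : \forall q \near p, `|F p - F q| < d by exact: ((cvgrPdist_lt _ _).1 cF _ d0).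
  rewrite (near_shift 0 p) in nF; move: nF.
  by apply: filterS => h /=; rewrite subr0 distrC.
have Ep : E (p, F p) = 0 := nbhs_singleton E0.
rewrite (near_shift 0 p) in E0.
have nd : \forall h \near (0 : V), `|h| < d by apply: nbhs0_lt.
apply: filterS (filterI nd (filterI cF' E0)) => h [hlt [klt /= Eh]].
rewrite subr0 in Eh.
set k := F (h + p) - F p in klt *.
have /= := hd (h, k).
have -> : ((h, k) : V * 'rV[R]_b) + (p, F p) = (h + p, F (h + p)).
  by congr pair; rewrite /= /k subrK.
rewrite Eh Ep subrr sub0r normrN => hk0.
have hk : `|'d E (p, F p) (h, k)| <= eta * (`|h| + `|k|).
  apply: le_trans (hk0 _) _.
    by rewrite -ball_normE /= sub0r normrN prod_normE gt_max hlt.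
  by rewrite ler_pM2l // prod_normE ge_max lerDl lerDr !normr_ge0.
(* dE (h, L h) = 0, so dE (h, k), which is small because E vanishes at both points,
   is the image of k - L h under the invertible partial differential. *)
have kL : k - L h = Minv ('d E (p, F p) (h, k)).
  rewrite (_ : (h, k) = (h, L h) + (0, k - L h)); last first.
    by congr pair; rewrite /= ?addr0 // addrC subrK.
  by rewrite linearD Lprop add0r dM /= mulmxK.
have kLle : `|k - L h| <= C * eta * (`|h| + `|k|).
  by rewrite kL (le_trans (hC _)) // -mulrA ler_pM2l.
have kle : `|k| <= (2 * K + 1) * `|h|.
  have k1 : `|k| <= `|k - L h| + `|L h| by rewrite -{1}(subrK (L h) k) ler_normD.
  have k2 := hK h.
  have k3 : C * eta * (`|h| + `|k|) <= 1 / 2 * (`|h| + `|k|) by rewrite ler_wpM2r // addr_ge0.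
  lra.
apply: le_trans kLle _; apply: le_trans (_ : C * eta * ((2 * K + 2) * `|h|) <= _); last first.
  by rewrite mulrA ler_wpM2r.
apply: ler_wpM2l; first by rewrite mulr_ge0 // ltW.
have -> : (2 * K + 2) * `|h| = `|h| + (2 * K + 1) * `|h| by ring.
by rewrite lerD2l.
Qed.

End Implicit.

(** * Euclidean distance and unit vectors *)

Section Euclid.
Context {R : realType} {d : nat}.
Implicit Types x y z u v : 'rV[R]_d.

(** The Euclidean scalar product. *)
Definition dotp u v : R := (u *m v^T) 0 0.

Lemma dotpE u v : dotp u v = \sum_i u 0 i * v 0 i.
Proof. by rewrite /dotp mxE; apply: eq_bigr => i _; rewrite mxE. Qed.

Lemma dotpC u v : dotp u v = dotp v u.
Proof. by rewrite !dotpE; apply: eq_bigr => i _; rewrite mulrC. Qed.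

Lemma dotpDl u v z : dotp (u + v) z = dotp u z + dotp v z.
Proof. by rewrite /dotp mulmxDl mxE. Qed.

Lemma dotpZl a u z : dotp (a *: u) z = a * dotp u z.
Proof. by rewrite /dotp -scalemxAl mxE. Qed.

Lemma dotpNl u z : dotp (- u) z = - dotp u z.
Proof. by rewrite /dotp mulNmx mxE. Qed.

Lemma dotpBl u v z : dotp (u - v) z = dotp u z - dotp v z.
Proof. by rewrite dotpDl dotpNl. Qed.

Lemma dotpDr u v z : dotp z (u + v) = dotp z u + dotp z v.
Proof. by rewrite dotpC dotpDl !(dotpC z). Qed.

Lemma dotpZr a u z : dotp z (a *: u) = a * dotp z u.
Proof. by rewrite dotpC dotpZl (dotpC z). Qed.

Lemma dotpNr u z : dotp z (- u) = - dotp z u.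
Proof. by rewrite dotpC dotpNl (dotpC z). Qed.

Lemma dotpBr u v z : dotp z (u - v) = dotp z u - dotp z v.
Proof. by rewrite dotpDr dotpNr. Qed.

Lemma dotp0l u : dotp 0 u = 0. Proof. by rewrite /dotp mul0mx mxE. Qed.

Lemma dotp0r u : dotp u 0 = 0. Proof. by rewrite dotpC dotp0l. Qed.

Lemma dotp_ge0 u : 0 <= dotp u u. Proof. exact: mulmx_trmx_ge0. Qed.

Lemma dotp_eq0 u : dotp u u = 0 -> u = 0. Proof. exact: mulmx_trmx_eq0. Qed.

Lemma dotp_gt0 u : u != 0 -> 0 < dotp u u.
Proof.
by move=> u0; rewrite lt_def dotp_ge0 andbT; apply: contra u0 => /eqP/dotp_eq0 ->.
Qed.

(** The unit vector from [y] to [x]. *)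
Definition unitv x y := (lagr x y)^-1 *: (x - y).

Lemma lagrE x y : lagr x y = Num.sqrt (dotp (x - y) (x - y)).
Proof. by rewrite /lagr dotpE; congr Num.sqrt; apply: eq_bigr => i _; rewrite !mxE expr2. Qed.

Lemma lagrC x y : lagr x y = lagr y x.
Proof. by rewrite !lagrE -(opprB y) dotpNl dotpNr opprK. Qed.

Lemma lagr_gt0 x y : x != y -> 0 < lagr x y.
Proof. by move=> xy; rewrite lagrE sqrtr_gt0 dotp_gt0 // subr_eq0. Qed.

Lemma lagr_sqr x y : lagr x y ^+ 2 = dotp (x - y) (x - y).
Proof. by rewrite lagrE sqr_sqrtr // dotp_ge0. Qed.

Lemma unitvC x y : unitv x y = - unitv y x.
Proof. by rewrite /unitv lagrC -scalerN opprB. Qed.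

Lemma dotp_unitv x y : x != y -> dotp (unitv x y) (unitv x y) = 1.
Proof.
move=> xy; rewrite /unitv dotpZl dotpZr -lagr_sqr.
by field; rewrite gt_eqF // lagr_gt0.
Qed.

Lemma lagr_unitv x y : x != y -> lagr x y *: unitv x y = x - y.
Proof. by move=> xy; rewrite scalerA divff ?scale1r // gt_eqF // lagr_gt0. Qed.

End Euclid.

Section LagrDiff.
Context {R : realType} {V : normedModType R} {d : nat}.
Variables (X Y : V -> 'rV[R]_d) (t : V).
Hypotheses (dX : differentiable X t) (dY : differentiable Y t) (XY : X t != Y t).

Let Z s := X s - Y s.

Let dZ : differentiable Z t. Proof. exact: differentiableB. Qed.

Let DZ v : 'D_v Z t = 'D_v X t - 'D_v Y t.
Proof. by apply: deriveB; exact: diff_derivable. Qed.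

Lemma derivable_dotp (A B : V -> 'rV[R]_d) s v : derivable A s v -> derivable B s v ->
  is_derive s v (fun r => dotp (A r) (B r)) (dotp ('D_v A s) (B s) + dotp (A s) ('D_v B s)).
Proof.
move=> dA dB.
have dBT : is_derive s v (fun r => (B r)^T) ('D_v B s)^T.
  have h : derivable (fun r => (B r)^T) s v.
    apply/derivable_mxP => i j; under eq_fun do rewrite mxE.
    exact: ((derivable_mxP _ _ _).1 dB).
  apply: DeriveDef => //; rewrite derive_mx //; apply/matrixP => i j.
  by rewrite !mxE -derive_coord //; under eq_fun do rewrite mxE.
have [h1 h2] := derivable_mulmx dA (ex_derive (is_derive := dBT)).
apply: DeriveDef; first exact: ((derivable_mxP _ _ _).1 h1).
by rewrite derive_coord // h2 (derive_val (is_derive := dBT)) mxE.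
Qed.

Lemma differentiable_dotp (A B : V -> 'rV[R]_d) s : differentiable A s ->
  differentiable B s -> differentiable (fun r => dotp (A r) (B r)) s.
Proof.
move=> dA dB; apply: ((differentiable_mxP _ _).1 _) 0 0.
apply: differentiable_mulmx => //; apply/differentiable_mxP => i j.
by under eq_fun do rewrite mxE; exact: ((differentiable_mxP _ _).1 dB).
Qed.

Lemma differentiable_lagr : differentiable (fun s => lagr (X s) (Y s)) t.
Proof.
rewrite (_ : (fun s => _) = Num.sqrt \o (fun s => dotp (Z s) (Z s))); last first.
  by apply/funext => s; rewrite lagrE.
apply: differentiable_comp; first exact: differentiable_dotp.
apply/derivable1_diffP; have [] // := @is_derive1_sqrt R (dotp (Z t) (Z t)) _.
by apply: dotp_gt0; rewrite subr_eq0.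
Qed.

Lemma derive_lagr v : 'D_v (fun s => lagr (X s) (Y s)) t =
  dotp ('D_v X t - 'D_v Y t) (unitv (X t) (Y t)).
Proof.
have L0 := lagr_gt0 XY.
have dL := differentiable_lagr.
have := derive_val (is_derive := derivable_dotp (diff_derivable (v := v) dZ) (diff_derivable (v := v) dZ)).
rewrite DZ (dotpC _ ('D_v X t - _)) -mulr2n.
rewrite (_ : (fun s => _) = (fun s => lagr (X s) (Y s)) * (fun s => lagr (X s) (Y s))); last first.
  by apply/funext => s; rewrite -lagr_sqr expr2.
rewrite deriveM; [|exact: diff_derivable|exact: diff_derivable].
rewrite /unitv dotpZr /Z; set D := 'D_v _ _; set W := dotp _ _; set l := lagr _ _ in L0 *.
rewrite /GRing.scale /= -mulr2n => /eqP; rewrite eqrMn2r //= => /eqP <-.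
by rewrite mulKf // gt_eqF.
Qed.

Lemma differentiable_unitv : differentiable (fun s => unitv (X s) (Y s)) t.
Proof.
have dL := differentiable_lagr; have L0 := lagr_gt0 XY.
apply/differentiable_mxP => i j.
rewrite (_ : (fun s => _) = (fun s => (lagr (X s) (Y s))^-1) * (fun s => Z s i j)); last first.
  by apply/funext => s; rewrite mxE.
apply: differentiableM; first by apply: differentiableV => //; rewrite gt_eqF.
exact: ((differentiable_mxP _ _).1 dZ).
Qed.

Lemma derive_unitv v : 'D_v (fun s => unitv (X s) (Y s)) t =
  (lagr (X t) (Y t))^-1 *: (('D_v X t - 'D_v Y t)
     - dotp ('D_v X t - 'D_v Y t) (unitv (X t) (Y t)) *: unitv (X t) (Y t)).
Proof.
have dL := differentiable_lagr; have L0 := lagr_gt0 XY.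
have dU := differentiable_unitv.
rewrite derive_mx; last exact: diff_derivable.
apply/matrixP => i j; rewrite mxE.
rewrite (_ : (fun s => _) = (fun s => (lagr (X s) (Y s))^-1) * (fun s => Z s i j)); last first.
  by apply/funext => s; rewrite mxE.
have dLV : derivable (fun s => (lagr (X s) (Y s))^-1) t v.
  by apply: diff_derivable; apply: differentiableV => //; rewrite gt_eqF.
rewrite deriveM //; last first.
  by apply: diff_derivable; exact: ((differentiable_mxP _ _).1 dZ).
rewrite derive_coord; last exact: diff_derivable.
rewrite DZ deriveV; [|by rewrite gt_eqF|exact: diff_derivable].
rewrite derive_lagr; set W := 'D_v X t - _; set e := unitv (X t) (Y t).
have ZE : Z t i j = lagr (X t) (Y t) * e i j.
  by rewrite /e /unitv [in RHS]mxE mulrA mulfV ?mul1r // gt_eqF.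
rewrite ZE !mxE /GRing.scale /=; field.
by rewrite gt_eqF.
Qed.

End LagrDiff.

(** * Hypersurfaces in graph charts *)

Section Charts.
Context {R : realType} {m : nat}.
Implicit Types (c : graph_chart R m) (g : 'rV[R]_m -> R) (u v w : 'rV[R]_m).

(** The gradient, as the row of partial derivatives along the canonical basis. *)
Definition grad g u : 'rV[R]_m := \row_j 'D_(delta_mx 0 j) g u.

Lemma smooth_partial g j : smooth g -> smooth (fun u => 'D_(delta_mx 0 j) g u).
Proof. by move=> sg k; have [] := sg k.+1 j. Qed.

Lemma smooth_differentiable g u : smooth g -> differentiable g u.
Proof.
move=> sg; have [] // := @continuous_partials_differentiable _ _ g u.
  by move=> j y; have [] := sg 1%N j.
by move=> j; exact: (smooth_partial j sg 0%N).
Qed.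

Lemma derive_grad g u v : smooth g -> 'D_v g u = dotp v (grad g u).
Proof.
move=> sg; have [|j|dg dE] := @continuous_partials_differentiable _ _ g u.
- by move=> j y; have [] := sg 1%N j.
- exact: (smooth_partial j sg 0%N).
rewrite deriveE // dE dotpE; apply: eq_bigr => j _; by rewrite mxE.
Qed.

Lemma grad_differentiable g u : smooth g -> differentiable (grad g) u.
Proof.
move=> sg; apply/differentiable_mxP => i j.
by under eq_fun do rewrite mxE; apply: smooth_differentiable; exact: smooth_partial.
Qed.

(** The rows of [jac c u] are the partial derivatives of [param c] at [u]; they span
    the tangent space. *)
Definition jac c u : 'M[R]_(m, 1 + m) :=
  row_mx (grad (height c) u)^T 1%:M *m frame c.

(** The normal vector pointing to the side of the larger heights, which is the
    inside of the domain; it is not normalized. *)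
Definition normal c u : 'rV[R]_(1 + m) :=
  row_mx 1%:M (- grad (height c) u) *m frame c.

Lemma differentiable_row_mx {V : normedModType R} p n1 n2 (A : V -> 'M[R]_(p, n1))
    (B : V -> 'M[R]_(p, n2)) t :
  differentiable A t -> differentiable B t ->
  differentiable (fun s => row_mx (A s) (B s)) t.
Proof.
move=> /differentiable_mxP dA /differentiable_mxP dB; apply/differentiable_mxP => i j.
by case: (split_ordP j) => k ->; under eq_fun do rewrite ?row_mxEl ?row_mxEr.
Qed.

Lemma derive_row_mx {V : normedModType R} p n1 n2 (A : V -> 'M[R]_(p, n1))
    (B : V -> 'M[R]_(p, n2)) (t v : V) :
  differentiable A t -> differentiable B t ->
  'D_v (fun s => row_mx (A s) (B s)) t = row_mx ('D_v A t) ('D_v B t).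
Proof.
move=> dA dB; have dAB := differentiable_row_mx dA dB.
rewrite derive_mx; last exact: diff_derivable.
apply/matrixP => i j; rewrite mxE; case: (split_ordP j) => k ->.
  under eq_fun do rewrite row_mxEl; rewrite row_mxEl derive_coord //.
  exact: diff_derivable.
under eq_fun do rewrite row_mxEr; rewrite row_mxEr derive_coord //.
exact: diff_derivable.
Qed.

Lemma derive_mulmx_cst {V : normedModType R} p n q (A : V -> 'M[R]_(p, n))
    (B : 'M[R]_(n, q)) (t v : V) :
  derivable A t v -> 'D_v (fun s => A s *m B) t = 'D_v A t *m B.
Proof.
move=> dA.
have := derive_val (is_derive := derivable_mulmx dA (derivable_cst B t v)).
by rewrite derive_cst mulmx0 addr0.
Qed.

Lemma param_differentiable c u : smooth (height c) -> differentiable (param c) u.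
Proof.
move=> sc; apply: differentiable_mulmx => //; apply: differentiable_row_mx => //.
apply/differentiable_mxP => i j.
rewrite (_ : (fun x => _) = height c); first exact: smooth_differentiable.
by apply/funext => x; rewrite !ord1 mxE eqxx.
Qed.

Lemma derive_param c u v : smooth (height c) -> 'D_v (param c) u = v *m jac c u.
Proof.
move=> sc.
have dh : differentiable (fun x => (height c x)%:M : 'M[R]_1) u.
  apply/differentiable_mxP => i j.
  rewrite (_ : (fun x => _) = height c); first exact: smooth_differentiable.
  by apply/funext => x; rewrite !ord1 mxE eqxx.
rewrite derive_mulmx_cst; last by apply: diff_derivable; exact: differentiable_row_mx.
rewrite derive_row_mx // derive_id /jac mulmxA mul_mx_row mulmx1; congr (row_mx _ _ *m _).
apply/matrixP => i j; rewrite !ord1 -derive_coord; last exact: diff_derivable.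
rewrite (_ : (fun x => _) = height c) ?derive_grad //.
by apply/funext => x; rewrite mxE eqxx.
Qed.

Lemma jac_differentiable c u : smooth (height c) -> differentiable (jac c) u.
Proof.
move=> sc; apply: differentiable_mulmx => //; apply: differentiable_row_mx => //.
apply/differentiable_mxP => i j; under eq_fun do rewrite mxE.
by apply: ((differentiable_mxP _ _).1 _); exact: grad_differentiable.
Qed.

Lemma normal_differentiable c u : smooth (height c) -> differentiable (normal c) u.
Proof.
move=> sc; apply: differentiable_mulmx => //; apply: differentiable_row_mx => //.
by apply: differentiableN; exact: grad_differentiable.
Qed.

Definition orthogonal_frame c := frame c *m (frame c)^T = 1%:M.

Lemma orthogonal_frameC c : orthogonal_frame c -> (frame c)^T *m frame c = 1%:M.
Proof. exact: mulmx1C. Qed.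

Lemma graph_coord_param c u : orthogonal_frame c -> graph_coord c (param c u) = u.
Proof. by move=> oc; rewrite /graph_coord /param -mulmxA oc mulmx1 row_mxKr. Qed.

Lemma level_param c u : orthogonal_frame c -> level c (param c u) = height c u.
Proof. by move=> oc; rewrite /level /param -mulmxA oc mulmx1 row_mxKl mxE eqxx. Qed.

Lemma param_graph_coord c q : orthogonal_frame c ->
  level c q = height c (graph_coord c q) -> param c (graph_coord c q) = q.
Proof.
move=> oc qE; rewrite /param -qE /level /graph_coord -mx11_scalar hsubmxK.
by rewrite -mulmxA orthogonal_frameC // mulmx1.
Qed.

Lemma dotp_frame c (p q : 'rV[R]_(1 + m)) : orthogonal_frame c ->
  dotp (p *m frame c) (q *m frame c) = dotp p q.
Proof. by move=> oc; rewrite /dotp trmx_mul mulmxA -(mulmxA p) oc mulmx1. Qed.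

Lemma jac_normal c u : orthogonal_frame c -> jac c u *m (normal c u)^T = 0.
Proof.
move=> oc; rewrite /jac /normal trmx_mul mulmxA -(mulmxA (row_mx _ _)) oc mulmx1.
by rewrite tr_row_mx mul_row_col linearN /= tr_scalar_mx mulmx1 mul1mx subrr.
Qed.

Lemma normal_neq0 c u : orthogonal_frame c -> normal c u != 0.
Proof.
move=> oc; apply/eqP => /(congr1 (mulmx^~ (frame c)^T)).
rewrite /normal -mulmxA oc mulmx1 mul0mx => /matrixP/(_ 0 (lshift m 0)).
by rewrite row_mxEl !mxE => /eqP; rewrite oner_eq0.
Qed.

Lemma frame_det_sqr c : orthogonal_frame c -> \det (frame c) ^+ 2 = 1.
Proof. by move=> oc; rewrite expr2 -{2}det_tr -det_mulmx oc det1. Qed.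

(** The frame factors out, and the remaining matrix has an identity block. *)
Lemma det_col_jac c u (e : 'rV[R]_(1 + m)) : orthogonal_frame c ->
  \det (col_mx e (jac c u)) = dotp e (normal c u) * \det (frame c).
Proof.
move=> oc; pose e' := e *m (frame c)^T.
have eE : e = e' *m frame c by rewrite /e' -mulmxA orthogonal_frameC // mulmx1.
have -> : col_mx e (jac c u) = col_mx e' (row_mx (grad (height c) u)^T 1%:M) *m frame c.
  by rewrite mul_col_mx -eE.
rewrite det_mulmx; congr (_ * _); rewrite eE dotp_frame //.
rewrite -[e']hsubmxK; set a := lsubmx e'; set b := rsubmx e'.
rewrite -[col_mx _ _]/(block_mx a b (grad (height c) u)^T 1%:M).
have -> : \det (block_mx a b (grad (height c) u)^T 1%:M) =
   \det (block_mx a b (grad (height c) u)^T 1%:M *m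
         block_mx 1%:M 0 (- (grad (height c) u)^T) 1%:M).
  by rewrite det_mulmx det_lblock !det1 !mulr1.
rewrite mulmx_block !mulmx1 !mulmx0 mul1mx subrr add0r add0r det_ublock det1 mulr1.
rewrite det_mx11 /dotp tr_row_mx mul_row_col tr_scalar_mx mulmx1 mulmxN.
by rewrite [(- _)^T](linearN trmx) mulmxN.
Qed.

(** Both sides are the determinant of the block matrix of scalar products of the rows
    of [col_mx e J'] and [col_mx e J]. *)
Lemma det_schur (e : 'rV[R]_(1 + m)) (J J' : 'M[R]_(m, 1 + m)) :
  dotp e e = 1 ->
  \det (J' *m (1%:M - e^T *m e) *m J^T) = \det (col_mx e J') * \det (col_mx e J).
Proof.
move=> e1; rewrite -(det_tr (col_mx e J)) -det_mulmx tr_col_mx mul_col_row.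
have -> : e *m e^T = 1%:M by rewrite [LHS]mx11_scalar -/(dotp e e) e1.
have -> : \det (block_mx 1%:M (e *m J^T) (J' *m e^T) (J' *m J^T)) =
  \det (block_mx 1%:M 0 (- (J' *m e^T)) 1%:M *m
        block_mx 1%:M (e *m J^T) (J' *m e^T) (J' *m J^T)).
  by rewrite det_mulmx det_lblock !det1 !mul1r.
rewrite mulmx_block !mul1mx !mul0mx !addr0 mulmx1 addNr det_ublock det1 mul1r.
by rewrite mulmxBr mulmx1 mulmxBl mulNmx !mulmxA addrC.
Qed.

(** The gradient of the distance with respect to the coordinates of its first
    endpoint, as a function of the coordinates of both endpoints. *)
Definition gradL c c' (p : 'rV[R]_m * 'rV[R]_m) : 'rV[R]_m :=
  unitv (param c p.1) (param c' p.2) *m (jac c p.1)^T.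

(** The partial derivative of [gradL c c'] with respect to the second endpoint, acting
    on row vectors from the right (see [derive_gradL2]). *)
Definition mixedL c c' u u' : 'M[R]_m :=
  - (lagr (param c u) (param c' u'))^-1 *:
    (jac c' u' *m (1%:M - (unitv (param c u) (param c' u'))^T *m unitv (param c u) (param c' u'))
      *m (jac c u)^T).

Lemma differentiable_trmx {V : normedModType R} p n (A : V -> 'M[R]_(p, n)) t :
  differentiable A t -> differentiable (fun s => (A s)^T) t.
Proof.
move=> /differentiable_mxP dA; apply/differentiable_mxP => i j.
by under eq_fun do rewrite mxE.
Qed.

Lemma differentiable_fst (U V : normedModType R) (p : U * V) : differentiable fst p.
Proof. by apply: linear_differentiable => q; exact: cvg_fst. Qed.

Lemma differentiable_snd (U V : normedModType R) (p : U * V) : differentiable snd p.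
Proof. by apply: linear_differentiable => q; exact: cvg_snd. Qed.

Lemma gradL_differentiable c c' p : smooth (height c) -> smooth (height c') ->
  param c p.1 != param c' p.2 -> differentiable (gradL c c') p.
Proof.
move=> sc sc' pp.
have d1 (W : normedModType R) (f : 'rV[R]_m -> W) : differentiable f p.1 ->
    differentiable (fun q : 'rV[R]_m * 'rV[R]_m => f q.1) p.
  by move=> df; apply: (@differentiable_comp _ _ _ _ fst f) => //; exact: differentiable_fst.
have d2 (W : normedModType R) (f : 'rV[R]_m -> W) : differentiable f p.2 ->
    differentiable (fun q : 'rV[R]_m * 'rV[R]_m => f q.2) p.
  by move=> df; apply: (@differentiable_comp _ _ _ _ snd f) => //; exact: differentiable_snd.
apply: differentiable_mulmx.
  by apply: differentiable_unitv => //; [apply: d1|apply: d2]; exact: param_differentiable.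
by apply: differentiable_trmx; apply: d1; exact: jac_differentiable.
Qed.

Lemma derive_gradL2 c c' u u' w : smooth (height c) -> smooth (height c') ->
  param c u != param c' u' ->
  'D_w (fun q => gradL c c' (u, q)) u' = w *m mixedL c c' u u'.
Proof.
move=> sc sc' pp; rewrite /gradL /=.
have dY := param_differentiable u' sc'.
have dX : differentiable (fun _ : 'rV[R]_m => param c u) u' by [].
rewrite derive_mulmx_cst; last by apply: diff_derivable; exact: differentiable_unitv.
rewrite derive_unitv // derive_cst sub0r derive_param // /mixedL.
set e := unitv _ _; set l := lagr _ _; set J := jac c' u'; set K := jac c u.
rewrite -scalemxAr scaleNr -scalerN -scalemxAl; congr (_ *: _); rewrite !mulmxA.
rewrite -[RHS]mulNmx; congr (_ *m _).
rewrite mulmxBr mulmx1 opprB dotpNl scaleNr opprK addrC; congr (_ + _).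
by rewrite /dotp -mul_scalar_mx -mx11_scalar mulmxA.
Qed.

End Charts.

(** * Mixed second derivatives of the distance and transversality *)

Lemma derive_pair_snd (R : numFieldType) (U V W : normedModType R)
    (G : U * V -> W) (u : U) (v w : V) :
  'D_(0, w) G (u, v) = 'D_w (fun q => G (u, q)) v.
Proof.
rewrite /derive.
suff -> : (fun h : R => h^-1 *: (G (h *: (0, w) + (u, v)) - G (u, v))) =
    (fun h => h^-1 *: (G (u, h *: w + v) - G (u, v))) by [].
apply/funext => h; congr (_ *: (G _ - _)).
by congr pair; rewrite /= scaler0 add0r.
Qed.

Section MixedDerivative.
Context {R : realType} {m : nat}.
Implicit Types (c : graph_chart R m) (u v w : 'rV[R]_m) (x y z : 'rV[R]_(1 + m)).

Lemma lagr_param_differentiable c u x : smooth (height c) -> param c u != x ->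
  differentiable (fun q => lagr (param c q) x) u.
Proof.
by move=> sc ux; apply: differentiable_lagr => //; exact: param_differentiable.
Qed.

Lemma derive_lagr_param c u x v : smooth (height c) -> param c u != x ->
  'D_v (fun q => lagr (param c q) x) u = dotp v (unitv (param c u) x *m (jac c u)^T).
Proof.
move=> sc ux; rewrite derive_lagr //; last exact: param_differentiable.
by rewrite derive_cst subr0 derive_param // /dotp trmx_mul trmxK -[in LHS]mulmxA.
Qed.

Lemma param_near_neq c u x : smooth (height c) -> param c u != x ->
  \forall q \near u, param c q != x.
Proof.
move=> sc ux.
have cp : {for u, continuous (param c)} by apply: differentiable_continuous; exact: param_differentiable.
have d0 : 0 < `|param c u - x| by rewrite normr_gt0 subr_eq0.
have nq : \forall q \near u, `|param c u - param c q| < `|param c u - x|.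
  exact: ((cvgrPdist_lt _ _).1 cp _ d0).
apply: filterS nq => q.
by apply: contraTneq => ->; rewrite ltxx.
Qed.

(** Each factor of the Schur formula is the scalar product of the direction of the
    segment with the normal at one endpoint. *)
Lemma det_mixedL c c' u u' : orthogonal_frame c -> orthogonal_frame c' ->
  param c u != param c' u' ->
  let e := unitv (param c u) (param c' u') in
  \det (mixedL c c' u u') =
  (- (lagr (param c u) (param c' u'))^-1) ^+ m *
   ((dotp e (normal c' u') * \det (frame c')) * (dotp e (normal c u) * \det (frame c))).
Proof.
move=> oc oc' uu e; rewrite /mixedL detZ det_schur ?dotp_unitv //.
by rewrite !det_col_jac.
Qed.

(** The form of the twist condition is given by the matrix [mixedL] with its endpoints
    exchanged, which has the same determinant. *)
Lemma twist_det (D : set 'rV[R]_(1 + m)) x y c c' u u' : twist D x y ->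
  chart_at D x c -> chart_at D y c' -> x = param c u -> y = param c' u' -> x != y ->
  \det (mixedL c c' u u') != 0.
Proof.
move=> tw cx cy xE yE xy.
have [oc sc _] := cx; have [oc' sc' _] := cy.
have := tw c c' cx cy; rewrite xE yE !graph_coord_param // => nd.
have uu : param c u != param c' u' by rewrite -xE -yE.
have u'u : param c' u' != param c u by rewrite eq_sym.
have formE v w : 'D_v (fun q => 'D_w (fun u'0 => lagr (param c q) (param c' u'0)) u') u
     = dotp w (v *m mixedL c' c u' u).
  have -> : 'D_v (fun q => 'D_w (fun u'0 => lagr (param c q) (param c' u'0)) u') u =
      'D_v (fun q => dotp w (gradL c' c (u', q))) u.
    apply: near_eq_derive; have := param_near_neq sc uu.
    apply: filterS => q qu'.
    have -> : (fun r => lagr (param c q) (param c' r)) = (fun r => lagr (param c' r) (param c q)).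
      by apply/funext => r; rewrite lagrC.
    by rewrite derive_lagr_param // eq_sym.
  have dg : derivable (fun q => gradL c' c (u', q)) u v.
    have dJ : differentiable (fun=> (jac c' u')^T) u by [].
    apply: diff_derivable; apply: differentiable_mulmx dJ.
    apply: (@differentiable_unitv _ _ _ (fun=> param c' u') (param c)) => //.
    exact: param_differentiable.
  have := derive_val (is_derive := derivable_dotp (derivable_cst w u v) dg).
  by rewrite derive_cst dotp0l add0r derive_gradL2.
have d1 : \det (mixedL c' c u' u) != 0.
  apply/det0P => -[v v0 vM]; case/eqP: v0; apply: nd => w.
  by rewrite formE vM dotp0r.
move: d1; rewrite !det_mixedL // lagrC unitvC !dotpNl.
apply: contra => /eqP; set a := _ ^+ m; set p := dotp _ _; set q := dotp _ _ => e.
apply/eqP; rewrite -[RHS]e; ring.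
Qed.

(** Transversality of the segment at both endpoints. *)
Lemma det_mixedL_neq0 c c' u u' : orthogonal_frame c -> orthogonal_frame c' ->
  param c u != param c' u' -> \det (mixedL c c' u u') != 0 ->
  dotp (unitv (param c u) (param c' u')) (normal c u) != 0 /\
  dotp (unitv (param c u) (param c' u')) (normal c' u') != 0.
Proof.
move=> oc oc' uu; rewrite det_mixedL // !mulf_eq0 !negb_or.
by move=> /and3P[_ /andP[-> _] /andP[-> _]].
Qed.

(** The partial derivative of [gradL c c'] with respect to the first endpoint. *)
Definition selfL c c' u u' : 'M[R]_m :=
  lin1_mx (fun b : 'rV[R]_m => 'd (gradL c c') (u, u') (b, 0)).

Lemma diff_gradL c c' u u' v w : smooth (height c) -> smooth (height c') ->
  param c u != param c' u' ->
  'd (gradL c c') (u, u') (v, w) = v *m selfL c c' u u' + w *m mixedL c c' u u'.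
Proof.
move=> sc sc' uu.
have dg : differentiable (gradL c c') (u, u') by exact: gradL_differentiable.
rewrite (_ : (v, w) = (v, 0) + (0, w)); last by congr pair; rewrite /= ?addr0 ?add0r.
rewrite linearD; congr (_ + _).
  have lin : linear (fun b : 'rV[R]_m => 'd (gradL c c') (u, u') (b, 0)).
    move=> a x y; rewrite (_ : (a *: x + y, 0) = a *: (x, 0) + (y, 0)) ?linearP //.
    by congr pair; rewrite /= scaler0 addr0.
  pose LM := GRing.isLinear.Build R _ _ _ _ lin.
  pose L : {linear 'rV[R]_m -> 'rV[R]_m} := HB.pack (fun b : 'rV[R]_m => 'd (gradL c c') (u, u') (b, 0)) LM.
  by rewrite /selfL (mul_rV_lin1 L).
rewrite -(derive_gradL2 w sc sc' uu) -(deriveE (0, w) dg).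
exact: derive_pair_snd.
Qed.

End MixedDerivative.

(** * Convex domains near their boundary *)

Section ConvexSets.
Context {R : realType} {V : normedModType R}.
Variable D : set V.
Hypotheses (oD : open D) (cD : convex_set (D : set (convex_lmodType V))).
Implicit Types p q : V.

Lemma convex_segment p q (s : R) : D p -> D q -> 0 <= s <= 1 ->
  D (s *: p + (1 - s) *: q).
Proof.
move=> Dp Dq /andP[s0 s1].
have := cD (Itv01 s0 s1) (mem_set (Dp : D p)) (mem_set (Dq : D q)).
by rewrite inE.
Qed.

Lemma affine_continuous (a b : R) p q : {for q, continuous (fun r : V => a *: p + b *: r)}.
Proof.
apply: differentiable_continuous; apply: differentiableD => //.
Qed.

Lemma closure_nbhs_ex (A : set V) q (P : V -> Prop) : closure A q ->
  (\forall r \near q, P r) -> exists2 r, A r & P r.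
Proof. by move=> /[apply] -[r []]; exists r. Qed.

(** A segment from a point of an open convex set to a point of its closure stays in
    the set, except possibly at the second endpoint. *)
Lemma convex_open_closure p q (s : R) : D p -> closure D q -> 0 < s <= 1 ->
  D (s *: p + (1 - s) *: q).
Proof.
move=> Dp Dq /andP[s0 s1].
(* Replacing q by a nearby r in D moves the first endpoint p by b *: (q - r). *)
pose b := (1 - s) / s.
have c : {for q, continuous (fun r : V => (p + b *: q) - b *: r)}.
  have := @affine_continuous 1 (- b) (p + b *: q) q.
  by under [X in continuous_at _ X -> _]eq_fun do rewrite scale1r scaleNr.
have Dn : \forall r \near q, D (p + b *: q - b *: r).
  by apply: c; apply: open_nbhs_nbhs; split => //; rewrite addrK.
have [r Dr Dp'] := closure_nbhs_ex Dq Dn.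
have := @convex_segment _ _ s Dp' Dr; rewrite (ltW s0) s1 => /(_ isT).
congr (D _); rewrite scalerBr scalerDr !scalerA.
rewrite (_ : s * b = 1 - s); last by rewrite /b mulrC divfK // gt_eqF.
by rewrite subrK.
Qed.

Lemma convex_closure p q (s : R) : closure D p -> closure D q -> 0 <= s <= 1 ->
  closure D (s *: p + (1 - s) *: q).
Proof.
move=> Dp Dq /andP[s0 s1] B nB.
move: s0; rewrite le_eqVlt => /orP[/eqP s0|s0].
  by move: nB; rewrite -s0 scale0r add0r subr0 scale1r => /Dq.
have nB' : \forall r \near p, B (s *: r + (1 - s) *: q).
  have := @affine_continuous (1 - s) s q p; under [X in continuous_at _ X -> _]eq_fun do rewrite addrC.
  by apply.
have [r Dr Br] := closure_nbhs_ex Dp nB'.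
exists (s *: r + (1 - s) *: q); split => //.
by apply: convex_open_closure => //; rewrite s0.
Qed.

End ConvexSets.

Lemma line_continuous {R : numFieldType} {V : normedModType R} (w q : V) (t : R) :
  {for t, continuous (fun t : R => t *: w + q)}.
Proof.
apply: differentiable_continuous; apply: differentiableD; last exact: differentiable_cst.
by apply: (@differentiableZl _ _ _ id w t).
Qed.

Lemma near_line {R : numFieldType} {V : normedModType R} (w q : V) (P : V -> Prop) :
  (\forall r \near q, P r) -> \forall t \near (0 : R)^'+, P (t *: w + q).
Proof.
move=> nP.
have h : (t *: w + q) @[t --> (0 : R)] --> (0 : R) *: w + q := @line_continuous _ _ w q 0.
by rewrite scale0r add0r in h; move/cvg_at_right_filter : h; apply.
Qed.

Section Gap.
Context {R : realType} {m : nat}.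
Implicit Types (c : graph_chart R m) (u v : 'rV[R]_m) (p q w : 'rV[R]_(1 + m)).

(** The height of [q] above the graph: near the center of the chart, the domain is the
    set where the gap is positive. *)
Definition gap c q : R := level c q - height c (graph_coord c q).

Lemma graph_coord_differentiable c q : differentiable (graph_coord c) q.
Proof.
have d : differentiable (fun r : 'rV[R]_(1 + m) => r *m (frame c)^T) q by exact: differentiable_mulmx.
by have := differentiable_comp d (differentiable_rsubmx _).
Qed.

Lemma level_differentiable c q : differentiable (level c) q.
Proof.
have d : differentiable (fun r : 'rV[R]_(1 + m) => r *m (frame c)^T) q by exact: differentiable_mulmx.
apply: (@differentiable_comp _ _ _ _ (fun r => lsubmx (r *m (frame c)^T)) (fun M : 'M[R]_1 => M 0 0 : R)).
  by have := differentiable_comp d (differentiable_lsubmx _).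
exact: differentiable_coord.
Qed.

Lemma gap_differentiable c q : smooth (height c) -> differentiable (gap c) q.
Proof.
move=> sc; apply: differentiableB; first exact: level_differentiable.
apply: differentiable_comp; first exact: graph_coord_differentiable.
exact: smooth_differentiable.
Qed.

Lemma gap_continuous c q : smooth (height c) -> {for q, continuous (gap c)}.
Proof. by move=> sc; exact/differentiable_continuous/gap_differentiable. Qed.

Lemma graph_coord_linear c a p q : graph_coord c (a *: p + q) = a *: graph_coord c p + graph_coord c q.
Proof. by rewrite /graph_coord mulmxDl -scalemxAl linearP. Qed.

Lemma level_linear c a p q : level c (a *: p + q) = a * level c p + level c q.
Proof. by rewrite /level mulmxDl -scalemxAl !mxE. Qed.

Lemma derive_gap c q w : smooth (height c) -> orthogonal_frame c ->
  'D_w (gap c) q = dotp w (normal c (graph_coord c q)).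
Proof.
move=> sc oc.
have -> : dotp w (normal c (graph_coord c q)) =
    level c w - dotp (graph_coord c w) (grad (height c) (graph_coord c q)).
  have -> : w = (w *m (frame c)^T) *m frame c by rewrite -mulmxA orthogonal_frameC // mulmx1.
  rewrite dotp_frame //; set w' := w *m _.
  have -> : level c (w' *m frame c) = lsubmx w' 0 0 by rewrite /level -mulmxA oc mulmx1.
  have -> : graph_coord c (w' *m frame c) = rsubmx w' by rewrite /graph_coord -mulmxA oc mulmx1.
  rewrite -{1}[w']hsubmxK {1}/dotp tr_row_mx mul_row_col tr_scalar_mx mulmx1.
  by rewrite [(- _)^T](linearN trmx) mulmxN mxE [X in _ + X]mxE.
have dl : 'D_w (level c) q = level c w.
  apply: derive_val; apply: DeriveDef; first exact/diff_derivable/level_differentiable.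
  apply: cvg_lim => //; apply: cvg_near_cst; apply: filterS (nbhs_dnbhs_neq (0 : R)) => h h0.
  by rewrite /= level_linear addrK /GRing.scale /= mulKf.
have dh : 'D_w (fun r => height c (graph_coord c r)) q
    = dotp (graph_coord c w) (grad (height c) (graph_coord c q)).
  rewrite -derive_grad // /derive.
  suff -> : (fun h : R => h^-1 *: (height c (graph_coord c (h *: w + q)) - height c (graph_coord c q)))
   = (fun h => h^-1 *: (height c (h *: graph_coord c w + graph_coord c q) - height c (graph_coord c q))) by [].
  by apply/funext => h; rewrite graph_coord_linear.
rewrite /gap deriveB ?dl ?dh //; apply: diff_derivable; first exact: level_differentiable.
apply: differentiable_comp; first exact: graph_coord_differentiable.
exact: smooth_differentiable.
Qed.

Lemma pos_derive (V : normedModType R) (f : V -> R) (p w : V) :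
  derivable f p w -> 0 < 'D_w f p ->
  \forall t \near (0 : R)^'+, f p < f (t *: w + p).
Proof.
move=> df D0.
have n0 : \forall t \near (0 : R)^', 0 < t^-1 *: (f (t *: w + p) - f p).
  by apply: (cvgr_gt _ df).
move: n0; rewrite !near_withinE; apply: filterS => t h t0.
by move: (h (lt0r_neq0 t0)); rewrite pmulr_rgt0 ?invr_gt0 // subr_gt0.
Qed.

End Gap.

Section ChartDomain.
Context {R : realType} {m : nat}.
Variable D : set 'rV[R]_(1 + m).
Hypotheses (oD : open D) (cD : convex_set (D : set (convex_lmodType 'rV[R]_(1 + m)))).
Implicit Types (c : graph_chart R m) (u v : 'rV[R]_m) (p q w : 'rV[R]_(1 + m)).

Lemma near_gap p c : chart_at D p c -> \forall q \near p, D q <-> 0 < gap c q.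
Proof. by move=> [_ _]; apply: filterS => q; rewrite subr_gt0. Qed.

Lemma near_chart_at p c : chart_at D p c -> \forall q \near p, chart_at D q c.
Proof.
move=> [oc sc /nbhs_interior]; apply: filterS => q Dq.
by split.
Qed.

Lemma near_closure_gap p c : chart_at D p c ->
  \forall q \near p, closure D q -> 0 <= gap c q.
Proof.
move=> pc; have [_ sc _] := pc.
apply: filterS (nbhs_interior (near_gap pc)) => q nq Dq.
rewrite leNgt; apply/negP => gq.
have ng : \forall r \near q, gap c r < 0 by exact: (cvgr_lt _ (gap_continuous (q := q) sc) _ gq).
have [r Dr [gr Dgr]] := closure_nbhs_ex Dq (filterI ng nq).
by move/Dgr: Dr; rewrite ltNge (ltW gr).
Qed.

Lemma boundary_not_in p : boundary D p -> ~ D p.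
Proof. by move=> [_]; move/interior_id : oD => ->. Qed.

Lemma gap_boundary p c : boundary D p -> chart_at D p c -> gap c p = 0.
Proof.
move=> bp pc; apply/eqP; rewrite eq_le (nbhs_singleton (near_closure_gap pc)) ?andbT; last by case: bp.
by rewrite leNgt; apply/negP => /(nbhs_singleton (near_gap pc)); exact: boundary_not_in.
Qed.

Lemma param_boundary p c : boundary D p -> chart_at D p c ->
  param c (graph_coord c p) = p.
Proof.
move=> bp pc; have [oc _ _] := pc.
by apply: param_graph_coord => //; apply/eqP; rewrite -subr_eq0 -/(gap c p) gap_boundary.
Qed.

Lemma near_gap_boundary p c : chart_at D p c ->
  \forall q \near p, gap c q = 0 -> boundary D q.
Proof.
move=> pc; have [oc sc _] := pc.
apply: filterS (nbhs_interior (near_gap pc)) => q nq gq.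
have Dq : D q <-> 0 < gap c q := nbhs_singleton nq.
split; last by move=> /interior_subset; rewrite Dq gq ltxx.
move=> B nB.
pose w : 'rV[R]_(1 + m) := row_mx 1%:M 0 *m frame c.
have lw : level c w = 1 by rewrite /level -mulmxA oc mulmx1 row_mxKl mxE.
have gw : graph_coord c w = 0 by rewrite /graph_coord -mulmxA oc mulmx1 row_mxKr.
have n1 : \forall t \near (0 : R)^'+, B (t *: w + q).
  exact: (@near_line _ _ w q B nB).
have n2 : \forall t \near (0 : R)^'+, D (t *: w + q) <-> 0 < gap c (t *: w + q).
  exact: (@near_line _ _ w q (fun r => D r <-> 0 < gap c r) nq).
near (0 : R)^'+ => t.
have t0 : 0 < t by [].
exists (t *: w + q); split; last by near: t.
have -> : D (t *: w + q) <-> 0 < gap c (t *: w + q) by near: t.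
rewrite /gap level_linear graph_coord_linear lw gw scaler0 add0r mulr1.
by rewrite -addrA -/(gap c q) gq addr0.
Unshelve. all: by end_near. Qed.

(** A direction pointing to the side of the normal enters the domain. *)
Lemma enter_domain p c w : boundary D p -> chart_at D p c ->
  0 < dotp w (normal c (graph_coord c p)) ->
  \forall t \near (0 : R)^'+, D (t *: w + p).
Proof.
move=> bp pc w0; have [oc sc _] := pc.
have dg := gap_differentiable p sc.
have := pos_derive (f := gap c) (w := w) (diff_derivable dg).
rewrite derive_gap // (gap_boundary bp pc) => /(_ w0) n1.
have n2 : \forall t \near (0 : R)^'+, D (t *: w + p) <-> 0 < gap c (t *: w + p).
  exact: (near_line w (near_gap pc)).
by apply: filterS2 n1 n2 => t g [_]; apply.
Qed.

Lemma leave_closure p c w : boundary D p -> chart_at D p c ->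
  dotp w (normal c (graph_coord c p)) < 0 ->
  \forall t \near (0 : R)^'+, ~ closure D (t *: w + p).
Proof.
move=> bp pc w0; have [oc sc _] := pc.
have dg := gap_differentiable p sc.
have := pos_derive (f := - gap c) (w := w) (diff_derivable (differentiableN dg)).
rewrite deriveN; last exact: diff_derivable.
rewrite derive_gap // oppr_gt0 => /(_ w0) n1.
have n2 : \forall t \near (0 : R)^'+, closure D (t *: w + p) -> 0 <= gap c (t *: w + p).
  exact: (near_line w (near_closure_gap pc)).
apply: filterS2 n1 n2 => t; rewrite -[(- gap c) p]/(- gap c p).
rewrite -[(- gap c) (_ + _)]/(- gap c (t *: w + p)) ltrN2 (gap_boundary bp pc) => g h /h.
by rewrite leNgt g.
Qed.

(** A convex domain lies on the inner side of its tangent hyperplanes. *)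
Lemma inward p c q : boundary D p -> chart_at D p c -> closure D q ->
  0 <= dotp (q - p) (normal c (graph_coord c p)).
Proof.
move=> bp pc Dq; rewrite leNgt; apply/negP => /(leave_closure bp pc) n1.
near (0 : R)^'+ => t.
have : ~ closure D (t *: (q - p) + p) by near: t.
apply; have -> : t *: (q - p) + p = t *: q + (1 - t) *: p.
  by rewrite scalerBr scalerBl scale1r addrAC addrA.
apply: convex_closure => //; first by case: bp.
by apply/andP; split => //; near: t; exact: nbhs_right_le.
Unshelve. all: by end_near. Qed.

(** The normals at a point in two charts are proportional, because the side to which
    they point is determined by the domain. *)
Lemma normal_proportional p c c' : boundary D p -> chart_at D p c -> chart_at D p c' ->
  exists a, normal c' (graph_coord c' p) = a *: normal c (graph_coord c p).
Proof.
move=> bp pc pc'; set n := normal c _; set n' := normal c' _.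
have pos w : 0 < dotp w n' -> 0 <= dotp w n.
  move=> /(enter_domain bp pc') n1; rewrite leNgt; apply/negP => /(leave_closure bp pc) n2.
  near (0 : R)^'+ => t.
  have : ~ closure D (t *: w + p) by near: t.
  by apply; apply: subset_closure; near: t.
have n'0 : 0 < dotp n' n' by apply: dotp_gt0; apply: normal_neq0; case: pc'.
(* A direction tangent in the chart c' is a limit of entering directions. *)
have orth0 w : dotp w n' = 0 -> 0 <= dotp w n.
  move=> w0; apply/ler_addgt0Pr => e e0.
  pose s := e / (`|dotp n' n| + 1).
  have s0 : 0 < s by rewrite divr_gt0 // ltr_wpDl.
  have : 0 <= dotp (w + s *: n') n by apply: pos; rewrite dotpDl dotpZl w0 add0r mulr_gt0.
  rewrite dotpDl dotpZl => /le_trans; apply; rewrite lerD2l.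
  apply: (@le_trans _ _ (s * (`|dotp n' n| + 1))); last by rewrite /s divfK // gt_eqF // ltr_wpDl.
  by rewrite ler_pM2l // (le_trans (ler_norm _)) // lerDl.
have orth w : dotp w n' = 0 -> dotp w n = 0.
  move=> w0; apply/eqP; rewrite eq_le orth0 // andbT -oppr_ge0 -dotpNl orth0 //.
  by rewrite dotpNl w0 oppr0.
pose w := n - (dotp n n' / dotp n' n') *: n'.
have w1 : dotp w n' = 0 by rewrite /w dotpBl dotpZl divfK ?subrr // gt_eqF.
have w2 : w = 0.
  by apply: dotp_eq0; rewrite {2}/w dotpBr dotpZr w1 mulr0 subr0 orth.
have nE : n = (dotp n n' / dotp n' n') *: n' by apply/eqP; rewrite -subr_eq0 -/w w2.
set a := _ / _ in nE.
have a0 : a != 0.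
  apply/eqP => a0; have : n != 0 by apply: normal_neq0; case: pc.
  by rewrite nE a0 scale0r eqxx.
by exists a^-1; rewrite nE scalerA mulVf // scale1r.
Unshelve. all: by end_near. Qed.

End ChartDomain.

(** * The reflection law determines the next point *)

Section Reflection.
Context {R : realType} {m : nat}.
Implicit Types (c : graph_chart R m) (u v : 'rV[R]_m) (x y z p q w n e : 'rV[R]_(1 + m)).

Lemma is_derive_lagr_sum c v x z (w : 'rV[R]_m) : smooth (height c) ->
  param c v != x -> param c v != z ->
  is_derive v w (fun u => lagr x (param c u) + lagr (param c u) z)
    (dotp w ((unitv (param c v) x + unitv (param c v) z) *m (jac c v)^T)).
Proof.
move=> sc vx vz.
have -> : (fun u => lagr x (param c u) + lagr (param c u) z) =
    (fun u => lagr (param c u) x) + (fun u => lagr (param c u) z).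
  by apply/funext => u; rewrite lagrC.
have dx := lagr_param_differentiable sc vx.
have dz := lagr_param_differentiable sc vz.
apply: DeriveDef; first by apply: derivableD; exact: diff_derivable.
rewrite deriveD; [|exact: diff_derivable|exact: diff_derivable].
by rewrite !derive_lagr_param // mulmxDl dotpDr.
Qed.

(** The sum of the two unit vectors is orthogonal to the tangent space. *)
Lemma reflection_tangent c v x z : smooth (height c) ->
  param c v != x -> param c v != z ->
  (forall w : 'rV[R]_m, is_derive v w (fun u => lagr x (param c u) + lagr (param c u) z) 0) <->
  (unitv (param c v) x + unitv (param c v) z) *m (jac c v)^T = 0.
Proof.
move=> sc vx vz; split=> [h|h w].
  apply: dotp_eq0; set s := _ *m _.
  have h1 := is_derive_lagr_sum s sc vx vz.
  by rewrite -(derive_val (is_derive := h1)) (derive_val (is_derive := h s)).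
by have := is_derive_lagr_sum w sc vx vz; rewrite h dotp0r.
Qed.

Lemma tangent_orthogonal_normal c u p : orthogonal_frame c -> p *m (jac c u)^T = 0 ->
  exists a, p = a *: normal c u.
Proof.
move=> oc.
have [p' ->] : exists p', p = p' *m frame c.
  by exists (p *m (frame c)^T); rewrite -mulmxA orthogonal_frameC // mulmx1.
rewrite /jac trmx_mul -mulmxA (mulmxA (frame c)) oc mul1mx.
rewrite -{1}[p']hsubmxK tr_row_mx mul_row_col trmxK trmx1 mulmx1.
move=> /(canRL (addKr _)); rewrite addr0 => h.
exists (lsubmx p' 0 0); rewrite /normal scalemxAl; congr (_ *m _).
rewrite -{1}[p']hsubmxK h scale_row_mx; congr row_mx.
  by rewrite scale_scalar_mx mulr1 -mx11_scalar.
by rewrite scalerN [in LHS](mx11_scalar (lsubmx p')) mul_scalar_mx.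
Qed.

(** The vector symmetric to [e] with respect to the line spanned by [n].  When [e]
    points from [x] to [y] and [n] is normal at [y], it points from the next point to
    [y]. *)
Definition mirror n e := (2 * dotp e n / dotp n n) *: n - e.

(** Two unit vectors whose sum is a multiple of [n] are symmetric about [n] or
    opposite; the sign conditions exclude the second case. *)
Lemma mirror_unique n e e' (a : R) : dotp e e = 1 -> dotp e' e' = 1 ->
  e + e' = a *: n -> n != 0 -> dotp e n < 0 -> dotp e' n <= 0 ->
  e' = mirror n e.
Proof.
move=> e1 e1' ee n0 en en'.
have nn := dotp_gt0 n0.
have e'E : e' = a *: n - e by rewrite -ee addrC addKr.
have : a * (a * dotp n n - 2 * dotp e n) = 0.
  move: e1'; rewrite e'E dotpBl !dotpBr !dotpZl !dotpZr (dotpC n e) e1.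
  by move=> h; apply: (addIr 1); rewrite add0r -[RHS]h; ring.
move/eqP; rewrite mulf_eq0 => /orP[/eqP a0|].
  by move: en'; rewrite e'E a0 scale0r sub0r dotpNl oppr_le0 leNgt en.
rewrite subr_eq0 => /eqP aE; rewrite e'E /mirror -aE mulfK // gt_eqF //.
Qed.

Lemma dotp_mirror n e : n != 0 -> dotp (mirror n e) n = dotp e n.
Proof.
move=> n0; have nn := dotp_gt0 n0; rewrite /mirror dotpBl dotpZl divfK ?gt_eqF //.
by ring.
Qed.

Lemma dotp_mirror_mirror n e : n != 0 -> dotp (mirror n e) (mirror n e) = dotp e e.
Proof.
move=> n0; have nn := dotp_gt0 n0.
rewrite /mirror dotpBl !dotpBr !dotpZl !dotpZr (dotpC n e).
by field; rewrite gt_eqF.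
Qed.

Variable D : set 'rV[R]_(1 + m).
Hypotheses (oD : open D) (cD : convex_set (D : set (convex_lmodType 'rV[R]_(1 + m)))).

Lemma dotp_unitv_sgn x y n : x != y -> dotp (unitv y x) n < 0 <-> 0 < dotp (x - y) n.
Proof.
move=> xy; rewrite /unitv -(opprB x) scalerN dotpNl dotpZl oppr_lt0.
by rewrite pmulr_rgt0 // invr_gt0 lagr_gt0 // eq_sym.
Qed.

(** Among the two directions allowed by criticality, the one that prolongs the segment
    [x, y] leaves the closure of the domain. *)
Lemma reflected_direction c x y z : boundary D y -> chart_at D y c ->
  x != y -> z != y -> closure D z ->
  0 < dotp (x - y) (normal c (graph_coord c y)) -> reflection D x y z ->
  unitv y z = mirror (normal c (graph_coord c y)) (unitv y x).
Proof.
move=> by_ yc xy zy Dz xn [c' yc' refl].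
have [oc sc _] := yc; have [oc' sc' _] := yc'.
have yE' := param_boundary oD by_ yc'.
move/reflection_tangent : refl; rewrite yE' ![y == _]eq_sym => /(_ sc' xy zy).
move=> /(tangent_orthogonal_normal oc')[a].
have [b ->] := normal_proportional oD by_ yc yc'; rewrite scalerA => ee.
apply: mirror_unique ee _ _ _.
- by rewrite dotp_unitv // eq_sym.
- by rewrite dotp_unitv // eq_sym.
- exact: normal_neq0.
- exact/dotp_unitv_sgn.
- rewrite /unitv -(opprB z) scalerN dotpNl dotpZl oppr_le0 mulr_ge0 //.
    by rewrite invr_ge0 ltW // lagr_gt0 // eq_sym.
  exact: (inward oD cD by_ yc Dz).
Qed.

(** On a ray from [y] that enters the domain, every point between [y] and a boundary
    point is interior. *)
Lemma ray_boundary_unique c y z1 z2 : boundary D y -> chart_at D y c ->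
  boundary D z1 -> boundary D z2 -> z1 != y -> z2 != y ->
  unitv y z1 = unitv y z2 ->
  dotp (unitv y z2) (normal c (graph_coord c y)) < 0 ->
  ~~ (lagr y z1 < lagr y z2).
Proof.
move=> by_ yc b1 b2 zy1 zy2 ee /(dotp_unitv_sgn _ zy2) pos; apply/negP => l12.
have L1 : 0 < lagr y z1 by rewrite lagr_gt0 // eq_sym.
have L2 : 0 < lagr y z2 by rewrite lagr_gt0 // eq_sym.
pose r := lagr y z1 / lagr y z2.
have r0 : 0 < r by rewrite divr_gt0.
have r1 : r < 1 by rewrite ltr_pdivrMr // mul1r.
have z1E : z1 = r *: (z2 - y) + y.
  have h1 := lagr_unitv (_ : y != z1); have h2 := lagr_unitv (_ : y != z2).
  apply/eqP; rewrite -subr_eq; apply/eqP.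
  rewrite -(opprB y) -h1 1?eq_sym // -(opprB y z2) -h2 1?eq_sym // ee scalerN [r *: (_ *: _)]scalerA.
  by rewrite /r divfK // gt_eqF.
have n1 := enter_domain oD by_ yc pos.
(* z1 lies strictly between an interior point of the ray, close to y, and z2. *)
near (0 : R)^'+ => t.
have t0 : 0 < t by [].
have tr : t < r by near: t; exact: nbhs_right_lt.
have Dt : D (t *: (z2 - y) + y) by near: t.
apply: (boundary_not_in oD b1).
pose s := (1 - r) / (1 - t).
have t1 : 0 < 1 - t by rewrite subr_gt0 (lt_trans tr).
have -> : z1 = s *: (t *: (z2 - y) + y) + (1 - s) *: z2.
  have rE : r = s * t + (1 - s) by rewrite /s; field; rewrite gt_eqF.
  rewrite z1E rE; apply/rowP => i; rewrite !mxE; ring.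
apply: convex_open_closure => //; first by case: b2.
apply/andP; split; first by rewrite divr_gt0 // subr_gt0.
by rewrite ler_pdivrMr // mul1r lerD2l lerN2 ltW.
Unshelve. all: by end_near. Qed.

Lemma next_point_unique c x y z1 z2 : boundary D y -> chart_at D y c ->
  x != y -> 0 < dotp (x - y) (normal c (graph_coord c y)) ->
  boundary D z1 -> boundary D z2 -> z1 != y -> z2 != y ->
  reflection D x y z1 -> reflection D x y z2 -> z1 = z2.
Proof.
move=> by_ yc xy xn b1 b2 zy1 zy2 r1 r2; have [oc _ _] := yc.
have e1 := reflected_direction by_ yc xy zy1 (proj1 b1) xn r1.
have e2 := reflected_direction by_ yc xy zy2 (proj1 b2) xn r2.
have n0 := normal_neq0 (graph_coord c y) oc.
have neg : dotp (mirror (normal c (graph_coord c y)) (unitv y x)) (normal c (graph_coord c y)) < 0.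
  by rewrite dotp_mirror //; exact/dotp_unitv_sgn.
have l21 := ray_boundary_unique by_ yc b1 b2 zy1 zy2.
have l12 := ray_boundary_unique by_ yc b2 b1 zy2 zy1.
rewrite e1 e2 in l12 l21.
have lE : lagr y z1 = lagr y z2.
  by apply/eqP; rewrite eq_le !leNgt l12 // l21.
have : y - z1 = y - z2 by rewrite -!lagr_unitv 1?eq_sym // e1 e2 lE.
by move/addrI/oppr_inj.
Qed.

Lemma next_pointE c x y z : boundary D y -> chart_at D y c ->
  x != y -> 0 < dotp (x - y) (normal c (graph_coord c y)) ->
  boundary D z -> z != y -> reflection D x y z -> next_point D x y = z.
Proof.
move=> by_ yc xy xn bz zy rz; apply: xget_unique; first by split => //; exact/eqP.
move=> z' [bz' /eqP zy' rz'].
exact: (next_point_unique by_ yc xy xn).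
Qed.

End Reflection.

(** * Differentiability of the billiard map *)

Section Step.
Context {R : realType} {m : nat}.

Lemma unitv_scale d (y z e : 'rV[R]_d) (t : R) : 0 < t -> dotp e e = 1 ->
  y - z = t *: e -> unitv y z = e.
Proof.
move=> t0 e1 yz; rewrite /unitv lagrE yz dotpZl dotpZr e1 mulr1 -expr2 sqrtr_sqr.
by rewrite gtr0_norm // scalerA mulVf ?scale1r // gt_eqF.
Qed.

Lemma differentiable_mirror {V : normedModType R} (n e : V -> 'rV[R]_(1 + m)) t :
  differentiable n t -> differentiable e t -> n t != 0 ->
  differentiable (fun s => mirror (n s) (e s)) t.
Proof.
move=> dn de n0; have nn := dotp_gt0 n0.
apply: differentiableB => //.
apply/differentiable_mxP => i j.
rewrite (_ : (fun s => _) = (fun s => 2 * dotp (e s) (n s)) * (fun s => (dotp (n s) (n s))^-1) * (fun s => n s i j)); last first.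
  by apply/funext => s; rewrite mxE.
apply: differentiableM; last exact: ((differentiable_mxP _ _).1 dn).
apply: differentiableM.
  by apply: differentiableM => //; exact: differentiable_dotp.
by apply: differentiableV; [exact: differentiable_dotp|rewrite gt_eqF].
Qed.

(** In the rest of this section [x0], [y0], [z0] are consecutive points of a trajectory,
    with charts [c0], [c1], [c2]; [tr1] and [tr2] say that the segments are
    transversal to the boundary at their second endpoints.  [X], [Y] are the points
    with coordinates [p] near [x0], [y0], and [ray p] is the reflected ray from [Y p],
    with unit direction [dir p]. *)
Variable D : set 'rV[R]_(1 + m).
Hypotheses (oD : open D) (cD : convex_set (D : set (convex_lmodType 'rV[R]_(1 + m)))).
Variables (c0 c1 c2 : graph_chart R m) (x0 y0 z0 : 'rV[R]_(1 + m)).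
Let u0 := graph_coord c0 x0.
Let v0 := graph_coord c1 y0.
Let w0 := graph_coord c2 z0.
Hypotheses (bx : boundary D x0) (by_ : boundary D y0) (bz : boundary D z0).
Hypotheses (ch0 : chart_at D x0 c0) (ch1 : chart_at D y0 c1) (ch2 : chart_at D z0 c2).
Hypotheses (xy : x0 != y0) (zy : z0 != y0).
Hypotheses (tr1 : 0 < dotp (x0 - y0) (normal c1 v0))
           (tr2 : 0 < dotp (y0 - z0) (normal c2 w0)).
Hypothesis crit : (unitv y0 x0 + unitv y0 z0) *m (jac c1 v0)^T = 0.

Let V := ('rV[R]_m * 'rV[R]_m)%type.
Let p0 : V := (u0, v0).

Let X (p : V) := param c0 p.1.
Let Y (p : V) := param c1 p.2.
Let dir (p : V) := - mirror (normal c1 p.2) (unitv (Y p) (X p)).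
Let ray (p : V) (t : R) := t *: dir p + Y p.

Let s0 : smooth (height c0). Proof. by case: ch0. Qed.
Let s1 : smooth (height c1). Proof. by case: ch1. Qed.
Let s2 : smooth (height c2). Proof. by case: ch2. Qed.
Let o1 : orthogonal_frame c1. Proof. by case: ch1. Qed.
Let o2 : orthogonal_frame c2. Proof. by case: ch2. Qed.

Let X0 : X p0 = x0. Proof. exact: (param_boundary oD bx ch0). Qed.
Let Y0 : Y p0 = y0. Proof. exact: (param_boundary oD by_ ch1). Qed.
Let Z0 : param c2 w0 = z0. Proof. exact: (param_boundary oD bz ch2). Qed.

Let d1 (W : normedModType R) (f : 'rV[R]_m -> W) : differentiable f p0.1 ->
    differentiable (fun q : V => f q.1) p0.
Proof. by move=> df; apply: (@differentiable_comp _ _ _ _ fst f) => //; exact: differentiable_fst. Qed.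

Let d2 (W : normedModType R) (f : 'rV[R]_m -> W) : differentiable f p0.2 ->
    differentiable (fun q : V => f q.2) p0.
Proof. by move=> df; apply: (@differentiable_comp _ _ _ _ snd f) => //; exact: differentiable_snd. Qed.

Let dX : differentiable X p0. Proof. by apply: d1; exact: param_differentiable. Qed.
Let dY : differentiable Y p0. Proof. by apply: d2; exact: param_differentiable. Qed.
Let dN : differentiable (fun p : V => normal c1 p.2) p0.
Proof. by apply: d2; exact: normal_differentiable. Qed.

Let ddir : differentiable dir p0.
Proof.
apply: differentiableN; apply: differentiable_mirror => //.
  by apply: differentiable_unitv => //; rewrite X0 Y0 eq_sym.
exact: normal_neq0.
Qed.

Let dray t : differentiable (ray ^~ t) p0.
Proof. by apply: differentiableD => //; exact: differentiableZ. Qed.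

Let l0 := lagr y0 z0.

Let l0_gt0 : 0 < l0. Proof. by rewrite lagr_gt0 // eq_sym. Qed.

Let dir0 : dir p0 = - unitv y0 z0.
Proof.
rewrite /dir X0 Y0 /=; congr (- _); apply/esym.
apply: (reflected_direction oD cD) => //; first by case: bz.
exists c1 => //; apply/reflection_tangent; rewrite // -/v0 (param_boundary oD by_ ch1) //.
  by rewrite eq_sym.
by rewrite eq_sym.
Qed.

Let ray0 (s : R) : ray p0 (l0 + s) = s *: dir p0 + z0.
Proof.
rewrite /ray Y0 scalerDl addrAC addrC; congr (_ + _).
rewrite dir0 scalerN lagr_unitv 1?eq_sym // opprB subrK.
done.
Qed.

(** For points near [x0], [y0] the next point is close to [z0] and satisfies the
    reflection law in the given charts. *)
Lemma next_point_near (W : set 'rV[R]_(1 + m)) : nbhs z0 W ->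
  \forall p \near p0,
    let N := next_point D (param c0 p.1) (param c1 p.2) in
    [/\ W N, param c2 (graph_coord c2 N) = N &
        gradL c1 c0 (p.2, p.1) + gradL c1 c2 (p.2, graph_coord c2 N) = 0].
Proof.
move=> nW.
have [r /= r0 ballr] := (nbhs_ballP _ _).1 (filterI nW (near_gap_boundary ch2)).
have dirn : dotp (dir p0) (normal c2 w0) < 0.
  rewrite dir0 dotpNl oppr_lt0 /unitv dotpZl mulr_gt0 // invr_gt0 //.
have dg := gap_differentiable z0 s2.
have g0 : gap c2 z0 = 0 by exact: (gap_boundary oD bz ch2).
have n1 : \forall s \near (0 : R)^'+, gap c2 (s *: dir p0 + z0) < 0.
  have := pos_derive (f := - gap c2) (w := dir p0) (diff_derivable (differentiableN dg)).
  rewrite deriveN; last exact: diff_derivable.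
  rewrite derive_gap // oppr_gt0 => /(_ dirn); apply: filterS => s.
  rewrite -[(- gap c2) z0]/(- gap c2 z0).
  by rewrite -[(- gap c2) (_ + _)]/(- gap c2 (s *: dir p0 + z0)) ltrN2 g0.
have n2 : \forall s \near (0 : R)^'+, 0 < gap c2 (s *: (- dir p0) + z0).
  have := pos_derive (f := gap c2) (w := - dir p0) (diff_derivable dg).
  by rewrite derive_gap // dotpNl oppr_gt0 g0; apply.
pose K := `|dir p0| + 1.
have K0 : 0 < K by rewrite ltr_wpDl.
(* The base ray crosses the boundary between the parameters l0 - s and l0 + s, so
   nearby rays do. *)
have [s [s_gt0 sl0 sr g1 g2]] : exists s : R, [/\ 0 < s, s < l0, s < r / 2 / K,
    gap c2 (s *: dir p0 + z0) < 0 & 0 < gap c2 (s *: (- dir p0) + z0)].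
  near (0 : R)^'+ => s; exists s; split.
  - by [].
  - by near: s; exact: nbhs_right_lt.
  - by near: s; apply: nbhs_right_lt; rewrite !divr_gt0.
  - by near: s.
  - by near: s.
have cray t : {for p0, continuous (ray ^~ t)} by exact: differentiable_continuous.
have cgray t : {for p0, continuous (fun p => gap c2 (ray p t))}.
  apply: (@continuous_comp _ _ _ (ray ^~ t) (gap c2)); first exact: cray.
  exact: gap_continuous.
have m1 : \forall p \near p0, gap c2 (ray p (l0 + s)) < 0.
  by apply: (cvgr_lt _ (cgray (l0 + s))); rewrite ray0.
have m2 : \forall p \near p0, 0 < gap c2 (ray p (l0 - s)).
  by apply: (cvgr_gt _ (cgray (l0 - s))); rewrite ray0 scaleNr -scalerN.
have m3 : \forall p \near p0, `|dir p0 - dir p| < 1.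
  exact: ((cvgrPdist_lt _ _).1 (differentiable_continuous ddir) _ ltr01).
have m4 : \forall p \near p0, `|z0 - ray p l0| < r / 2.
  have := (cvgrPdist_lt _ _).1 (cray l0) (r / 2).
  by rewrite -[l0 in ray p0 l0]addr0 ray0 scale0r add0r; apply; rewrite divr_gt0.
have cY : {for p0, continuous Y} by exact: differentiable_continuous.
have m5 : \forall p \near p0, chart_at D (Y p) c1.
  have h : nbhs (Y p0) [set q | chart_at D q c1] by rewrite Y0; exact: near_chart_at.
  exact: (cY _ h).
have m6 : \forall p \near p0, gap c1 (Y p) = 0 -> boundary D (Y p).
  have h : nbhs (Y p0) [set q | gap c1 q = 0 -> boundary D q].
    by rewrite Y0; exact: near_gap_boundary.
  exact: (cY _ h).
have m7 : \forall p \near p0, 0 < dotp (X p - Y p) (normal c1 p.2).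
  have df : differentiable (fun p => dotp (X p - Y p) (normal c1 p.2)) p0.
    by apply: differentiable_dotp => //; exact: differentiableB.
  by apply: (cvgr_gt _ (differentiable_continuous df)); rewrite X0 Y0.
near=> p => /=.
have g1p : gap c2 (ray p (l0 + s)) < 0 by near: p.
have g2p : 0 < gap c2 (ray p (l0 - s)) by near: p.
have d1p : `|dir p0 - dir p| < 1 by near: p.
have r1p : `|z0 - ray p l0| < r / 2 by near: p.
have chp : chart_at D (Y p) c1 by near: p.
have gcY : graph_coord c1 (Y p) = p.2 by rewrite graph_coord_param.
have bp : boundary D (Y p).
  have : gap c1 (Y p) = 0 -> boundary D (Y p) by near: p.
  by apply; rewrite /gap gcY level_param // subrr.
have trp : 0 < dotp (X p - Y p) (normal c1 p.2) by near: p.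
have XYp : X p != Y p by apply: contraTneq trp => ->; rewrite subrr dotp0l ltxx.
have nn0 : normal c1 p.2 != 0 by exact: normal_neq0.
have dirp1 : dotp (- dir p) (- dir p) = 1.
  by rewrite /dir opprK dotp_mirror_mirror // dotp_unitv // eq_sym.
have [t /andP[t1 t2] gt] : exists2 t, l0 - s <= t <= l0 + s & gap c2 (ray p t) = 0.
  have [|||t tI gt] := @IVT R (fun t => gap c2 (ray p t)) (l0 - s) (l0 + s) 0.
  - by rewrite lerD2l; lra.
  - apply: continuous_subspaceT => t.
    apply: (@continuous_comp _ _ _ (ray p) (gap c2)); last exact: gap_continuous.
    exact: line_continuous.
  - by rewrite ge_min le_max (ltW g1p) (ltW g2p) !orbT.
  by exists t => //; move: tI; rewrite in_itv.
have t0 : 0 < t by rewrite (lt_le_trans _ t1) // subr_gt0.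
have [] : (W `&` [set q | gap c2 q = 0 -> boundary D q]) (ray p t).
  apply: ballr; rewrite -ball_normE /=.
  have -> : z0 - ray p t = (z0 - ray p l0) + (l0 - t) *: dir p.
    by rewrite /ray scalerBl; apply/rowP => i; rewrite !mxE; ring.
  apply: le_lt_trans (ler_normD _ _) _; rewrite (splitr r); apply: ltr_leD => //.
  rewrite normrZ; apply: (@le_trans _ _ (s * K)); last by rewrite -ler_pdivlMr // ltW.
  apply: ler_pM => //; first by rewrite ler_norml; apply/andP; split; lra.
  rewrite /K -{1}(subrK (dir p0) (dir p)) addrC (le_trans (ler_normD _ _)) //.
  by rewrite lerD2l distrC ltW.
set z := ray p t => Wz /(_ gt) bzp.
have cancel_ray (a b : 'rV[R]_(1 + m)) : b - (t *: a + b) = t *: (- a).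
  by rewrite scalerN opprD addrCA subrr addr0.
have YzE : Y p - z = t *: (- dir p) by exact: cancel_ray.
have zYp : z != Y p.
  apply/eqP => zE; have : t *: (- dir p) = 0 by rewrite -YzE zE subrr.
  move/eqP; rewrite scaler_eq0 gt_eqF //= => /eqP dE.
  by move: dirp1; rewrite dE dotp0l => /eqP; rewrite eq_sym oner_eq0.
have uz : unitv (Y p) z = - dir p by exact: (unitv_scale t0).
have cr : (unitv (Y p) (X p) + unitv (Y p) z) *m (jac c1 p.2)^T = 0.
  rewrite uz /dir opprK /mirror addrC subrK -scalemxAl.
  rewrite -[_ *m _]trmxK trmx_mul trmxK jac_normal // trmx0 scaler0 //.
have trp' : 0 < dotp (X p - Y p) (normal c1 (graph_coord c1 (Y p))) by rewrite gcY.
have YXp : param c1 p.2 != X p by rewrite eq_sym.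
have Yzp : param c1 p.2 != z by rewrite eq_sym.
have refl : reflection D (X p) (Y p) z.
  exists c1; first exact: chp.
  by rewrite gcY; exact: (reflection_tangent s1 YXp Yzp).2.
have NE : next_point D (param c0 p.1) (param c1 p.2) = z.
  exact: (next_pointE oD cD bp chp XYp trp' bzp zYp refl).
rewrite NE; have zE : param c2 (graph_coord c2 z) = z.
  by apply: param_graph_coord => //; apply/eqP; rewrite -subr_eq0 -/(gap c2 z) gt.
by split => //; rewrite /gradL /= zE -mulmxDl.
Unshelve. all: by end_near. Qed.

Lemma next_point_base : next_point D x0 y0 = z0.
Proof.
apply: (next_pointE oD cD by_ ch1) => //.
exists c1 => //; apply/reflection_tangent; rewrite // -/v0 (param_boundary oD by_ ch1) //.
  by rewrite eq_sym.
by rewrite eq_sym.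
Qed.

(** The billiard map in charts: the coordinates of the next point. *)
Definition step_coord (p : 'rV[R]_m * 'rV[R]_m) : 'rV[R]_m :=
  graph_coord c2 (next_point D (param c0 p.1) (param c1 p.2)).

Lemma step_coord_base : step_coord p0 = w0.
Proof. by rewrite /step_coord -/(X p0) -/(Y p0) X0 Y0 next_point_base. Qed.

(* Keeps unification from unfolding gradL when its composites are differentiated. *)
Local Opaque gradL.

(** The differential solves the linearized reflection law. *)
Lemma step_coord_differentiable : \det (mixedL c1 c2 v0 w0) != 0 ->
  differentiable step_coord p0 /\
  forall a b, a *m mixedL c1 c0 v0 u0 + b *m (selfL c1 c0 v0 u0 + selfL c1 c2 v0 w0)
    + 'd step_coord p0 (a, b) *m mixedL c1 c2 v0 w0 = 0.
Proof.
move=> dM.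
have cS : {for p0, continuous step_coord}.
  apply: (_ : step_coord @ p0 --> step_coord p0); apply/cvgrPdist_lt => e e0.
  rewrite step_coord_base.
  have ng : \forall q \near z0, `|w0 - graph_coord c2 q| < e.
    have cg := differentiable_continuous (graph_coord_differentiable c2 z0).
    exact: ((cvgrPdist_lt _ _).1 cg _ e0).
  by apply: filterS (next_point_near ng) => p [].
pose L1 (q : V * 'rV[R]_m) : V := (q.1.2, q.1.1).
pose L2 (q : V * 'rV[R]_m) : V := (q.1.2, q.2).
pose E (q : V * 'rV[R]_m) := gradL c1 c0 (L1 q) + gradL c1 c2 (L2 q).
have E0 : \forall p \near p0, E (p, step_coord p) = 0.
  by apply: filterS (next_point_near filterT) => p [].
have L1lin : linear L1 by [].
have L2lin : linear L2 by [].
have cL1 : continuous L1.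
  move=> q; apply: differentiable_continuous; apply: differentiable_pair.
    by apply: (@differentiable_comp _ _ _ _ fst snd); [exact: differentiable_fst|exact: differentiable_snd].
  by apply: (@differentiable_comp _ _ _ _ fst fst); exact: differentiable_fst.
have cL2 : continuous L2.
  move=> q; apply: differentiable_continuous; apply: differentiable_pair.
    by apply: (@differentiable_comp _ _ _ _ fst snd); [exact: differentiable_fst|exact: differentiable_snd].
  exact: differentiable_snd.
pose L1M := GRing.isLinear.Build R _ _ _ L1 L1lin.
pose L1L : {linear (V * 'rV[R]_m)%type -> V} := HB.pack L1 L1M.
pose L2M := GRing.isLinear.Build R _ _ _ L2 L2lin.
pose L2L : {linear (V * 'rV[R]_m)%type -> V} := HB.pack L2 L2M.
have q1 : param c1 v0 != param c0 u0 by rewrite -[param c1 v0]/(Y p0) -[param c0 u0]/(X p0) X0 Y0 eq_sym.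
have q2 : param c1 v0 != param c2 w0 by rewrite -[param c1 v0]/(Y p0) Y0 Z0 eq_sym.
have dG1 : differentiable (gradL c1 c0) (v0, u0) by exact: gradL_differentiable.
have dG2 : differentiable (gradL c1 c2) (v0, w0) by exact: gradL_differentiable.
have dL1 : differentiable L1 (p0, w0) by exact: (@linear_differentiable _ _ _ L1L).
have dL2 : differentiable L2 (p0, w0) by exact: (@linear_differentiable _ _ _ L2L).
have dE1 : differentiable (gradL c1 c0 \o L1) (p0, w0) by exact: differentiable_comp.
have dE2 : differentiable (gradL c1 c2 \o L2) (p0, w0) by exact: differentiable_comp.
have dE : differentiable E (p0, w0) by exact: differentiableD.
have regroup (A B C F : 'rV[R]_m) : (A + B) + (C + F) = B + (A + C) + F.
  by rewrite !addrA (addrC A).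
have EE a b w : 'd E (p0, w0) ((a, b), w) = a *m mixedL c1 c0 v0 u0
   + b *m (selfL c1 c0 v0 u0 + selfL c1 c2 v0 w0) + w *m mixedL c1 c2 v0 w0.
  pose h : V * 'rV[R]_m := ((a, b), w).
  have hE := congr1 (fun f => f h) (diffD dE1 dE2).
  have h1 := congr1 (fun f => f h) (diff_comp dL1 dG1).
  have h2 := congr1 (fun f => f h) (diff_comp dL2 dG2).
  have l1 := congr1 (fun f => f h) (diff_lin (f := L1L) (p0, w0) cL1).
  have l2 := congr1 (fun f => f h) (diff_lin (f := L2L) (p0, w0) cL2).
  have E1 : 'd (gradL c1 c0 \o L1) (p0, w0) h = b *m selfL c1 c0 v0 u0 + a *m mixedL c1 c0 v0 u0.
    rewrite -(diff_gradL b a s1 s0 q1).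
    exact: (etrans h1 (congr1 ('d (gradL c1 c0) (v0, u0)) l1)).
  have E2 : 'd (gradL c1 c2 \o L2) (p0, w0) h = b *m selfL c1 c2 v0 w0 + w *m mixedL c1 c2 v0 w0.
    rewrite -(diff_gradL b w s1 s2 q2).
    exact: (etrans h2 (congr1 ('d (gradL c1 c2) (v0, w0)) l2)).
  apply: (etrans hE); apply: (etrans (congr2 +%R E1 E2)).
  rewrite (mulmxDr b).
  exact: regroup.
have [||w|||dS dSE] := @implicit_differentiable R _ m E step_coord p0 (mixedL c1 c2 v0 w0).
- by rewrite step_coord_base.
- by rewrite unitmxE unitfE.
- by rewrite step_coord_base EE !mul0mx !add0r.
- exact: cS.
- exact: E0.
split => // a b; have := dSE (a, b).
by rewrite step_coord_base EE.
Qed.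

End Step.

(** * The Hessian of the length functional *)

Lemma near_eq_differentiable (R : numFieldType) (V W : normedModType R)
    (f g : V -> W) (p : V) :
  (\forall q \near p, f q = g q) -> differentiable g p -> differentiable f p.
Proof.
move=> fg dg; have fgp := nbhs_singleton fg.
have [] // := @eps_differentiable _ _ _ f ('d g p) p (diff_continuous dg).
move=> e e0; have dge := differentiable_eps dg e0.
rewrite (near_shift 0 p) in fg.
by apply: filterS2 fg dge => h /=; rewrite subr0 fgp => ->.
Qed.

Lemma derive_comp_linear (R : numFieldType) (U V W : normedModType R)
    (L : {linear U -> V}) (f : V -> W) (p w : U) :
  'D_w (fun q => f (L q)) p = 'D_(L w) f (L p).
Proof.
rewrite /derive.
suff -> : (fun h : R => h^-1 *: (f (L (h *: w + p)) - f (L p))) =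
   (fun h => h^-1 *: (f (h *: L w + L p) - f (L p))) by [].
by apply/funext => h; rewrite linearP.
Qed.

Section Length.
Context {R : realType} {m n : nat}.
Variable c : nat -> graph_chart R m.
Hypothesis sc : forall i, smooth (height (c i)).
Implicit Types (U V W : 'M[R]_(n, m)) (i : 'I_n).

Let pt i U := param (c i) (row i U).

Lemma row_differentiable i U : differentiable (row i : 'M[R]_(n, m) -> 'rV[R]_m) U.
Proof. exact: linear_mx_differentiable. Qed.

Lemma pt_differentiable i U : differentiable (pt i) U.
Proof.
apply: (@differentiable_comp _ _ _ _ (row i) (param (c i))); first exact: row_differentiable.
exact: param_differentiable.
Qed.

Lemma derive_pt i U W : 'D_W (pt i) U = row i W *m jac (c i) (row i U).
Proof.
rewrite -derive_param //.
exact: (@derive_comp_linear _ _ _ _ (row i : {linear 'M[R]_(n, m) -> 'rV[R]_m}) (param (c i))).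
Qed.

(** The gradient of the length with respect to the [i]-th point: the sum of the
    gradients of the distances to the two neighbours. *)
Definition length_grad i U : 'rV[R]_m :=
  gradL (c i) (c (ordS i)) (row i U, row (ordS i) U)
  + gradL (c i) (c (ord_pred i)) (row i U, row (ord_pred i) U).

(** Consecutive points are distinct, so that the length is differentiable. *)
Definition noncollapsed U := forall i, pt i U != pt (ordS i) U.

Lemma noncollapsed_pred U i : noncollapsed U -> pt i U != pt (ord_pred i) U.
Proof. by move=> nU; have := nU (ord_pred i); rewrite ord_predK eq_sym. Qed.

Lemma near_noncollapsed U : noncollapsed U -> \forall U' \near U, noncollapsed U'.
Proof.
move=> nU.
have h i : \forall U' \near U, pt i U' != pt (ordS i) U'.
  have dl := differentiable_lagr (pt_differentiable i U) (pt_differentiable (ordS i) U) (nU i).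
  have l0 := lagr_gt0 (nU i).
  have n0 : \forall U' \near U, 0 < lagr (pt i U') (pt (ordS i) U').
    exact: (cvgr_gt _ (differentiable_continuous dl) _ l0).
  apply: filterS n0 => U'; apply: contraTneq => ->.
  by rewrite lagrE subrr dotp0l sqrtr0 ltxx.
exact: (filter_forall _ h).
Qed.

Lemma local_lengthE : @local_length R m n c = \sum_i (fun U => lagr (pt i U) (pt (ordS i) U)).
Proof. by apply/funext => U; rewrite fct_sumE. Qed.

Lemma local_length_differentiable U : noncollapsed U ->
  differentiable (@local_length R m n c) U.
Proof.
move=> nU; rewrite local_lengthE; apply: differentiable_sum => i.
by apply: differentiable_lagr => //; exact: pt_differentiable.
Qed.

Lemma derive_local_length U W : noncollapsed U ->
  'D_W (@local_length R m n c) U = \sum_i dotp (row i W) (length_grad i U).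
Proof.
move=> nU; rewrite local_lengthE derive_sum => [|i]; last first.
  by apply: diff_derivable; apply: differentiable_lagr => //; exact: pt_differentiable.
under eq_bigr => i _.
  rewrite derive_lagr ?derive_pt //; [|exact: pt_differentiable|exact: pt_differentiable].
  rewrite dotpBl -dotpNr -unitvC.
  rewrite (_ : dotp _ _ = dotp (row i W) (gradL (c i) (c (ordS i)) (row i U, row (ordS i) U))); last first.
    by rewrite /dotp /gradL trmx_mul trmxK -[in LHS]mulmxA.
  rewrite (_ : dotp (_ *m _) _ = dotp (row (ordS i) W) (gradL (c (ordS i)) (c (ord_pred (ordS i))) (row (ordS i) U, row (ord_pred (ordS i)) U))); last first.
    by rewrite /dotp /gradL trmx_mul trmxK -[in LHS]mulmxA ordSK.
  over.
rewrite big_split /= -(reindex (@ordS n) (P := xpredT)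
  (F := fun j => dotp (row j W) (gradL (c j) (c (ord_pred j)) (row j U, row (ord_pred j) U)))) /=; last first.
  exact/onW_bij/ordS_bij.
by rewrite -big_split; apply: eq_bigr => i _; rewrite /length_grad dotpDr.
Qed.

Lemma length_grad_part i j U : pt i U != pt j U ->
  differentiable (fun U => gradL (c i) (c j) (row i U, row j U)) U /\
  forall V, 'D_V (fun U => gradL (c i) (c j) (row i U, row j U)) U =
    row i V *m selfL (c i) (c j) (row i U) (row j U)
    + row j V *m mixedL (c i) (c j) (row i U) (row j U).
Proof.
move=> ij; pose L U := (row i U, row j U).
have Llin : linear L by move=> a A B; congr pair; exact: linearP.
pose LM := GRing.isLinear.Build R _ _ _ L Llin.
pose LL : {linear 'M[R]_(n, m) -> ('rV[R]_m * 'rV[R]_m)%type} := HB.pack L LM.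
have dG : differentiable (gradL (c i) (c j)) (row i U, row j U) by exact: gradL_differentiable.
split.
  apply: (@differentiable_comp _ _ _ _ L (gradL (c i) (c j))) => //.
  exact: (linear_mx_differentiable LL).
move=> V; rewrite -(diff_gradL (row i V) (row j V) (sc i) (sc j) ij) -(deriveE _ dG).
exact: (@derive_comp_linear _ _ _ _ LL (gradL (c i) (c j)) U V).
Qed.

Lemma length_grad_differentiable i U : noncollapsed U -> differentiable (length_grad i) U.
Proof.
move=> nU; apply: differentiableD; first exact: (length_grad_part (nU i)).1.
exact: (length_grad_part (noncollapsed_pred i nU)).1.
Qed.

Lemma derive_length_grad i U V : noncollapsed U ->
  'D_V (length_grad i) U =
    row (ord_pred i) V *m mixedL (c i) (c (ord_pred i)) (row i U) (row (ord_pred i) U)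
    + row i V *m (selfL (c i) (c (ordS i)) (row i U) (row (ordS i) U)
                 + selfL (c i) (c (ord_pred i)) (row i U) (row (ord_pred i) U))
    + row (ordS i) V *m mixedL (c i) (c (ordS i)) (row i U) (row (ordS i) U).
Proof.
move=> nU; have [d1 e1] := length_grad_part (nU i).
have [d2 e2] := length_grad_part (noncollapsed_pred i nU).
rewrite /length_grad deriveD; [|exact: diff_derivable|exact: diff_derivable].
rewrite e1 e2 mulmxDr.
have regroup (A B C F : 'rV[R]_m) : A + B + (C + F) = F + (A + C) + B.
  by apply/rowP => k; rewrite !mxE; ring.
exact: regroup.
Qed.

Lemma second_derive_local_length U V W : noncollapsed U ->
  'D_V (fun U => 'D_W (@local_length R m n c) U) U =
  \sum_i dotp ('D_V (length_grad i) U) (row i W).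
Proof.
move=> nU.
rewrite (near_eq_derive (g := \sum_i (fun U => dotp (row i W) (length_grad i U)))); last first.
  apply: filterS (near_noncollapsed nU) => U' nU'.
  by rewrite derive_local_length // fct_sumE.
have dgi i := length_grad_differentiable i nU.
have h i := derivable_dotp (derivable_cst (row i W) U V) (diff_derivable (v := V) (dgi i)).
rewrite derive_sum => [|i]; last exact: (ex_derive (is_derive := h i)).
apply: eq_bigr => i _; rewrite (derive_val (is_derive := h i)).
by rewrite derive_cst dotp0l add0r dotpC.
Qed.

Lemma derive_local_length_differentiable U W : noncollapsed U ->
  differentiable (fun U => 'D_W (@local_length R m n c) U) U.
Proof.
move=> nU.
apply: (near_eq_differentiable (g := \sum_i (fun U => dotp (row i W) (length_grad i U)))).
  apply: filterS (near_noncollapsed nU) => U' nU'.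
  by rewrite derive_local_length // fct_sumE.
apply: differentiable_sum => i; apply: differentiable_dotp => //.
exact: length_grad_differentiable.
Qed.

Lemma second_derive_sym U V W : noncollapsed U ->
  'D_V (fun U => 'D_W (@local_length R m n c) U) U =
  'D_W (fun U => 'D_V (@local_length R m n c) U) U.
Proof.
move=> nU; have nd := near_noncollapsed nU.
apply: derive_commute; try exact: derive_local_length_differentiable.
  by apply: filterS nd => U' nU'; apply: diff_derivable; exact: local_length_differentiable.
by apply: filterS nd => U' nU'; apply: diff_derivable; exact: local_length_differentiable.
Qed.

Lemma critical_length_grad U : noncollapsed U ->
  (forall V, is_derive U V (@local_length R m n c) 0) -> forall i, length_grad i U = 0.
Proof.
move=> nU crit i; apply: dotp_eq0.
pose V : 'M[R]_(n, m) := \matrix_j (if j == i then length_grad i U else 0).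
have := derive_local_length V nU; rewrite (derive_val (is_derive := crit V)).
rewrite (bigD1 i) //= rowK eqxx big1 ?addr0 // => j /negbTE ji.
by rewrite rowK ji dotp0l.
Qed.

End Length.

(** * Periodic trajectories and multipliers *)

Lemma periodic_modn (T : Type) (f : nat -> T) n : (forall i, f (i + n)%N = f i) ->
  forall i, f (i %% n)%N = f i.
Proof.
move=> fn i; rewrite {2}(divn_eq i n).
by elim: (i %/ n)%N => [//|q ->]; rewrite mulSnr addnAC fn.
Qed.

(** In this section the charts [c i] along the trajectory are repeated with the period
    of the trajectory, and [u i] are the coordinates of the point [x i]. *)

Section Trajectory.
Context {R : realType} {m n : nat}.
Variable D : set 'rV[R]_(1 + m).
Hypotheses (oD : open D) (cD : convex_set (D : set (convex_lmodType 'rV[R]_(1 + m)))).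
Variables (x : nat -> 'rV[R]_(1 + m)) (c : nat -> graph_chart R m).
Hypotheses (n1 : (1 < n)%N) (traj : periodic_trajectory D n x)
  (cx : charts_along D x c) (cn : forall i, c (i + n)%N = c i).

Let u i := graph_coord (c i) (x i).

Let xn i : x (i + n)%N = x i. Proof. by case: traj. Qed.
Let un i : u (i + n)%N = u i. Proof. by rewrite /u xn cn. Qed.
Let bx i : boundary D (x i). Proof. by case: traj. Qed.
Let xx i : x i != x i.+1. Proof. by apply/eqP; case: traj. Qed.
Let sc i : smooth (height (c i)). Proof. by case: (cx i). Qed.
Let oc i : orthogonal_frame (c i). Proof. by case: (cx i). Qed.
Let px i : param (c i) (u i) = x i. Proof. exact: (param_boundary oD (bx i) (cx i)). Qed.

Let pxx i : param (c i) (u i) != param (c i.+1) (u i.+1). Proof. by rewrite !px. Qed.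

Lemma det_step_neq0 i : \det (mixedL (c i) (c i.+1) (u i) (u i.+1)) != 0.
Proof.
have [_ _ _ _ tw] := traj.
apply: (twist_det (tw i) (cx i) (cx i.+1)); by rewrite ?px.
Qed.

(** The scalar product is nonnegative by convexity and nonzero by the twist
    condition. *)
Lemma transversal_end i : 0 < dotp (x i - x i.+1) (normal (c i.+1) (u i.+1)).
Proof.
have [_] := det_mixedL_neq0 (oc i) (oc i.+1) (pxx i) (det_step_neq0 i).
rewrite !px lt_def /unitv dotpZl mulf_eq0 negb_or => /andP[_ ->] /=.
by apply: (inward oD cD (bx _) (cx _)); case: (bx i).
Qed.

Lemma transversal_start i : 0 < dotp (x i.+1 - x i) (normal (c i) (u i)).
Proof.
have [+ _] := det_mixedL_neq0 (oc i) (oc i.+1) (pxx i) (det_step_neq0 i).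
rewrite !px lt_def /unitv dotpZl mulf_eq0 negb_or -(opprB (x i)) dotpNl oppr_eq0 => /andP[_ ->] /=.
by rewrite -dotpNl opprB; apply: (inward oD cD (bx _) (cx _)); case: (bx i.+1).
Qed.

(** The factor [(-1)^m] comes from the sign of [mixedL], the last [-1] from the
    directions of the segment at its two endpoints. *)
Lemma det_step i : exists2 a, 0 < a &
  \det (mixedL (c i) (c i.+1) (u i) (u i.+1)) =
  (-1) ^+ m.+1 * a * (\det (frame (c i)) * \det (frame (c i.+1))).
Proof.
have l0 := lagr_gt0 (xx i).
exists ((lagr (x i) (x i.+1))^-1 ^+ m.+2 * (dotp (x i.+1 - x i) (normal (c i) (u i))
   * dotp (x i - x i.+1) (normal (c i.+1) (u i.+1)))).
  apply: mulr_gt0; first by rewrite exprn_gt0 // invr_gt0.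
  by apply: mulr_gt0; [exact: transversal_start|exact: transversal_end].
have -> : dotp (x i.+1 - x i) (normal (c i) (u i)) = - dotp (x i - x i.+1) (normal (c i) (u i)).
  by rewrite -dotpNl opprB.
rewrite det_mixedL // !px /unitv !dotpZl.
rewrite (_ : - (lagr (x i) (x i.+1))^-1 = -1 * (lagr (x i) (x i.+1))^-1) ?mulN1r // -mulN1r.
by rewrite exprMn !exprS; ring.
Qed.

(** Each frame determinant occurs twice around the cycle, and its square is 1. *)
Lemma det_steps_sign : exists2 a, 0 < a &
  \prod_(i < n) \det (mixedL (c i) (c i.+1) (u i) (u i.+1)) = (-1) ^+ (m.+1 * n) * a.
Proof.
have [a a0 aE] : exists2 a : nat -> R, (forall i, 0 < a i) & forall i,
    \det (mixedL (c i) (c i.+1) (u i) (u i.+1)) =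
    (-1) ^+ m.+1 * a i * (\det (frame (c i)) * \det (frame (c i.+1))).
  exists (fun i => s2val (cid2 (det_step i))) => i; first exact: (s2valP (cid2 (det_step i))).
  exact: (s2valP' (cid2 (det_step i))).
exists (\prod_(i < n) a i); first by apply: prodr_gt0.
under eq_bigr do rewrite aE.
rewrite !big_split /= prodr_const card_ord exprM -[RHS]mulr1; congr (_ * _).
have -> : \prod_(i < n) \det (frame (c i.+1)) = \prod_(i < n) \det (frame (c i)).
  rewrite [RHS](reindex (@ordS n)) /=; last exact/onW_bij/ordS_bij.
  by apply: eq_bigr => i _; rewrite (periodic_modn cn).
rewrite -big_split big1 // => i _ /=; rewrite -expr2 frame_det_sqr //.
Qed.

Let U0 := coords_along n c x.

Let rowU0 (i : 'I_n) : row i U0 = u i. Proof. by rewrite rowK. Qed.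

Let cS (i : 'I_n) : c (ordS i) = c i.+1. Proof. exact: (periodic_modn cn). Qed.
Let uS (i : 'I_n) : u (ordS i) = u i.+1. Proof. exact: (periodic_modn un). Qed.

Let predE (T : Type) (f : nat -> T) (i : 'I_n) : (forall i, f (i + n)%N = f i) ->
  f (ord_pred i) = f (i + n.-1)%N.
Proof.
move=> fn; rewrite /= (periodic_modn fn); congr f; lia.
Qed.

Let cP (i : 'I_n) : c (ord_pred i) = c (i + n.-1)%N. Proof. exact: predE. Qed.
Let uP (i : 'I_n) : u (ord_pred i) = u (i + n.-1)%N. Proof. exact: predE. Qed.

Let nU0 : noncollapsed c U0.
Proof. by move=> i; rewrite !rowU0 cS uS. Qed.

Lemma critical_step i :
  (unitv (x i.+1) (x i) + unitv (x i.+1) (x i.+2)) *m (jac (c i.+1) (u i.+1))^T = 0.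
Proof.
have [_ _ _ crit _] := traj.
have n0 : (0 < n)%N by lia.
pose j : 'I_n := Ordinal (ltn_pmod i.+1 n0).
have fj (T : Type) (f : nat -> T) : (forall i, f (i + n)%N = f i) ->
    [/\ f j = f i.+1, f (ordS j) = f i.+2 & f (ord_pred j) = f i].
  move=> fn; split; first exact: (periodic_modn fn).
    by rewrite /= (periodic_modn fn) -addn1 -(addn1 i.+1) -[LHS](periodic_modn fn) modnDml (periodic_modn fn).
  rewrite predE // -[LHS](periodic_modn fn) /= modnDml (periodic_modn fn).
  by rewrite (_ : (i.+1 + n.-1 = i + n)%N) ?fn //; lia.
have := critical_length_grad sc nU0 (crit c cx) j.
rewrite /length_grad /gradL !rowU0 /=.
have [cj cSj cPj] := fj _ c cn; have [uj uSj uPj] := fj _ u un.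
rewrite -/(nat_of_ord j) -/(nat_of_ord (ordS j)) -/(nat_of_ord (ord_pred j)).
rewrite cj cSj cPj uj uSj uPj !px -mulmxDl addrC.
done.
Qed.

(* The blocks of the k-th equation, as derivatives with respect to the points of
   index k - 1, k and k + 1; k + n.-1 stands for k - 1. *)
Let P k := mixedL (c k) (c (k + n.-1)%N) (u k) (u (k + n.-1)%N).
Let A k := selfL (c k) (c k.+1) (u k) (u k.+1) + selfL (c k) (c (k + n.-1)%N) (u k) (u (k + n.-1)%N).
Let B k := mixedL (c k) (c k.+1) (u k) (u k.+1).

(** The blocks of the Hessian are those of the linearized reflection law. *)
Lemma hessianE V W : hessian c x V W = \sum_(i < n)
     ((row (ord_pred i) V *m P i + row i V *m A i + row (ordS i) V *m B i)
       *m (row i W)^T) 0 0.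
Proof.
rewrite /hessian second_derive_local_length //; apply: eq_bigr => i _.
rewrite (derive_length_grad sc _ _ nU0) (rowU0 i) (rowU0 (ordS i)) (rowU0 (ord_pred i)).
by rewrite (cS i) (cP i) (uS i) (uP i).
Qed.

Lemma hessian_sym V W : hessian (n := n) c x V W = hessian c x W V.
Proof. exact: second_derive_sym. Qed.

Let step k := step_coord D (c k) (c k.+1) (c k.+2).

Lemma step_base k : step k (u k, u k.+1) = u k.+2.
Proof.
apply: (step_coord_base oD cD _ (bx _) (bx _) (bx _) (cx _) (cx _)) => //.
- by rewrite eq_sym.
- exact: transversal_end.
- exact: critical_step.
Qed.

Lemma step_diff k : differentiable (step k) (u k, u k.+1) /\
  forall a b, a *m P k.+1 + b *m A k.+1 + 'd (step k) (u k, u k.+1) (a, b) *m B k.+1 = 0.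
Proof.
have [|||||dS dSE] := step_coord_differentiable oD cD (bx k) (bx k.+1) (bx k.+2) (cx _) (cx _) (cx _) (xx k).
- by rewrite eq_sym.
- exact: transversal_end.
- exact: transversal_end.
- exact: critical_step.
- exact: det_step_neq0.
have kn (T : Type) (f : nat -> T) : (forall i, f (i + n)%N = f i) -> f (k.+1 + n.-1)%N = f k.
  by move=> fn; rewrite -[RHS]fn; congr f; lia.
have PE : P k.+1 = mixedL (c k.+1) (c k) (u k.+1) (u k).
  by rewrite /P (kn _ c cn) (kn _ u un).
have AE : A k.+1 = selfL (c k.+1) (c k) (u k.+1) (u k)
                   + selfL (c k.+1) (c k.+2) (u k.+1) (u k.+2).
  by rewrite /A (kn _ c cn) (kn _ u un); exact: addrC.
split; first exact: dS.
by move=> a b; rewrite PE AE; exact: dSE.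
Qed.

Lemma step_near k : \forall p \near (u k, u k.+1),
  param (c k.+2) (step k p) = next_point D (param (c k) p.1) (param (c k.+1) p.2).
Proof.
have [] : True /\ nbhs (x k.+2) setT by split => //; exact: filterT.
move=> _ /(next_point_near oD cD (bx k) (bx k.+1) (bx k.+2) (cx _) (cx _) (cx _) (xx k)) h.
have := h _ (transversal_end k) (transversal_end k.+1) (critical_step k).
rewrite eq_sym => /(_ (xx _)).
by apply: filterS => p [].
Qed.

Lemma unit_step k : B k.+1 \in unitmx.
Proof. by rewrite unitmxE unitfE; exact: det_step_neq0. Qed.

(** A variation of the trajectory multiplied by [rho > 1] after one period. *)
Lemma unstable_variation :
  nondegenerate_form (hessian (n := n) c x) ->
  (-1) ^+ (m + n + morse_index (hessian (n := n) c x)) < 0 :> R ->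
  exists2 rho : R, 1 < rho & exists v : nat -> 'rV[R]_m,
    [/\ forall k, v (k + n)%N = rho *: v k,
        forall k, v k *m P k.+1 + v k.+1 *m A k.+1 + v k.+2 *m B k.+1 = 0 &
        exists k, v k != 0].
Proof.
move=> hnd sgn.
have kS (T : Type) (f : nat -> T) i : (forall i, f (i + n)%N = f i) ->
    f (i + n).+1 = f i.+1 by move=> fn; rewrite -addSn fn.
have kP (T : Type) (f : nat -> T) i : (forall i, f (i + n)%N = f i) ->
    f (i + n + n.-1)%N = f (i + n.-1)%N by move=> fn; rewrite addnAC fn.
have Pn i : P (i + n)%N = P i by rewrite /P (cn i) (un i) (kP _ c i cn) (kP _ u i un).
have An i : A (i + n)%N = A i.
  by rewrite /A (cn i) (un i) (kS _ c i cn) (kS _ u i un) (kP _ c i cn) (kP _ u i un).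
have Bn i : B (i + n)%N = B i by rewrite /B (cn i) (un i) (kS _ c i cn) (kS _ u i un).
apply: (@unstable_solution R n m P A B (hessian c x) n1 Pn An Bn hessianE hessian_sym hnd).
have [a a0 ->] := det_steps_sign.
rewrite mulrA -exprD (_ : (-1) ^+ _ = (-1) ^+ (m + n + morse_index (hessian (n := n) c x))).
  by rewrite pmulr_llt0.
rewrite -signr_odd -[RHS]signr_odd; congr (_ ^+ nat_of_bool _).
case: n n1 => [//|n' _]; rewrite !oddD !oddM /=.
by case: (odd m); case: (odd n'); case: (odd (morse_index _)).
Qed.

Variable v : nat -> 'rV[R]_m.
Hypothesis vE : forall k, v k *m P k.+1 + v k.+1 *m A k.+1 + v k.+2 *m B k.+1 = 0.

Lemma variation_step k : 'd (step k) (u k, u k.+1) (v k, v k.+1) = v k.+2.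
Proof.
have [_ dSE] := step_diff k; apply: (can_inj (mulmxK (unit_step k))).
by apply: (addrI (v k *m P k.+1 + v k.+1 *m A k.+1)); rewrite dSE vE.
Qed.

Lemma variation_eq0 : v 0%N = 0 -> v 1%N = 0 -> forall k, v k = 0.
Proof.
move=> v0 v1 k; suff [] : v k = 0 /\ v k.+1 = 0 by [].
elim: k => [//|k [vk vk1]]; split => //.
have := vE k; rewrite vk vk1 !mul0mx !add0r => /(congr1 (mulmx^~ (invmx (B k.+1)))).
by rewrite (mulmxK (unit_step k)) mul0mx.
Qed.

Let w0 : 'rV[R]_(m + m) := row_mx (u 0%N) (u 1%N).
Let om : 'rV[R]_(m + m) := row_mx (v 0%N) (v 1%N).

(** The iterates of the billiard map, read in the charts along the trajectory: their
    differential carries [(v_0, v_1)] to [(v_k, v_(k+1))]. *)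
Lemma iter_billiard_charts k : exists a b : 'rV[R]_(m + m) -> 'rV[R]_m,
  [/\ differentiable a w0 /\ differentiable b w0,
      a w0 = u k /\ b w0 = u k.+1,
      'd a w0 om = v k /\ 'd b w0 om = v k.+1 &
      \forall w \near w0,
        iter k (billiard_map D) (param (c 0%N) (lsubmx w), param (c 1%N) (rsubmx w))
        = (param (c k) (a w), param (c k.+1) (b w))].
Proof.
elim: k => [|k [a [b [[da db] [a0 b0] [dav dbv] ab]]]].
  exists lsubmx, rsubmx; split.
  - by split; [exact: differentiable_lsubmx|exact: differentiable_rsubmx].
  - by rewrite row_mxKl row_mxKr.
  - pose L : {linear 'rV[R]_(m + m) -> 'rV[R]_m} := lsubmx.
    pose R' : {linear 'rV[R]_(m + m) -> 'rV[R]_m} := rsubmx.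
    have l1 := congr1 (fun f => f om) (diff_lin (f := L) w0 (linear_mx_continuous (f := L))).
    have l2 := congr1 (fun f => f om) (diff_lin (f := R') w0 (linear_mx_continuous (f := R'))).
    split; first exact: (etrans l1 (row_mxKl _ _)).
    exact: (etrans l2 (row_mxKr _ _)).
  - by near=> w.
pose p w := (a w, b w).
have dp : differentiable p w0 by exact: differentiable_pair.
have p0 : p w0 = (u k, u k.+1) by rewrite /p a0 b0.
have [dS _] := step_diff k; rewrite -p0 in dS.
exists b, (step k \o p); split.
- by split => //; exact: differentiable_comp.
- by rewrite /= p0 step_base.
- split; first exact: dbv.
  have h1 := congr1 (fun f => f om) (diff_comp dp dS).
  have h2 := congr1 (fun f => f om) (diff_pair da db).
  have h3 : 'd p w0 om = (v k, v k.+1) := etrans h2 (congr2 pair dav dbv).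
  have vk := variation_step k; rewrite -p0 in vk.
  exact: (etrans h1 (etrans (congr1 ('d (step k) (p w0)) h3) vk)).
have sn := step_near k; rewrite -p0 in sn.
have sp : \forall w \near w0, param (c k.+2) (step k (p w)) =
    next_point D (param (c k) (p w).1) (param (c k.+1) (p w).2).
  exact: (differentiable_continuous dp sn).
apply: filterS2 ab sp => w abw spw; rewrite iterS abw /billiard_map /= spw.
by [].
Unshelve. all: by end_near. Qed.

Lemma quasi_periodic_multiplier (rho : R) : (forall k, v (k + n)%N = rho *: v k) ->
  (exists k, v k != 0) -> multiplier D n (c 0%N) (c 1%N) (x 0%N) (x 1%N) rho.
Proof.
move=> vn v0.
have [a [b [[da db] _ [dav dbv] ab]]] := iter_billiard_charts n.
have near_iter : \forall w \near w0, local_iter D n (c 0%N) (c 1%N) w = row_mx (a w) (b w).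
  apply: filterS ab => w; rewrite /local_iter => -> /=.
  by rewrite -(cn 0) -(cn 1) add0n add1n !graph_coord_param.
have dab : differentiable (fun w => row_mx (a w) (b w)) w0 by exact: differentiable_row_mx.
have dL := near_eq_differentiable near_iter dab.
split; first exact: dL.
apply/eigenvalueP; exists om; last first.
  apply/eqP => om0; have [k /eqP] := v0; apply; apply: variation_eq0.
    by rewrite -[LHS](row_mxKl (v 0%N) (v 1%N)) -/om om0 linear0.
  by rewrite -[LHS](row_mxKr (v 0%N) (v 1%N)) -/om om0 linear0.
rewrite -(deriveEjacobian om dL) (near_eq_derive om near_iter) derive_row_mx //.
have ea : 'D_om a w0 = v n := etrans (deriveE om da) dav.
have eb : 'D_om b w0 = v n.+1 := etrans (deriveE om db) dbv.
rewrite ea eb scale_row_mx; congr row_mx; first exact: (vn 0).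
exact: (vn 1).
Qed.

End Trajectory.

Lemma eq_hessian (R : realType) (m n : nat) (c c' : nat -> graph_chart R m)
    (x : nat -> 'rV[R]_(1 + m)) :
  (forall i, (i < n)%N -> c i = c' i) -> hessian (n := n) c x = hessian c' x.
Proof.
move=> cc.
have LL : @local_length R m n c = local_length c'.
  by apply/funext => U; apply: eq_bigr => i _; rewrite !cc.
have CC : coords_along n c x = coords_along n c' x.
  by apply/row_matrixP => i; rewrite !rowK cc.
by apply/funext => V; apply/funext => W; rewrite /hessian LL CC.
Qed.

Theorem corollary2p6 (R : realType) (m n : nat) (D : set 'rV[R]_(1 + m))
    (x : nat -> 'rV[R]_(1 + m)) (c : nat -> graph_chart R m)
    (D_dom : smooth_convex_domain D)
    (n_gt0 : (0 < n)%N)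
    (x_traj : periodic_trajectory D n x)
    (c_charts : charts_along D x c)
    (x_nondeg : nondegenerate_form (@hessian R m n c x))
    (x_sign : (-1) ^+ (m + n + morse_index (@hessian R m n c x)) < 0 :> R) :
  exists2 rho : R, 1 < rho & multiplier D n (c 0%N) (c 1%N) (x 0%N) (x 1%N) rho.
Proof.
have [oD _ cD _] := D_dom.
have [xn _ xx _ _] := x_traj.
have n_gt1 : (1 < n)%N.
  have := n_gt0; rewrite leq_eqVlt => /orP[/eqP n1|//].
  by have := xn 0%N; rewrite -n1 => x1; case: (xx 0%N).
(* only the charts of index less than n matter; they are repeated periodically *)
have [c' [c'n c'x hE c0 c1]] : exists c', [/\ forall i, c' (i + n)%N = c' i,
    charts_along D x c', hessian (n := n) c x = hessian c' x,
    c' 0%N = c 0%N & c' 1%N = c 1%N].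
  exists (fun i => c (i %% n)%N); split.
  - by move=> i; rewrite modnDr.
  - by move=> i; rewrite -(periodic_modn xn).
  - by apply: eq_hessian => i i_n; rewrite modn_small.
  - by congr (c _); exact: mod0n.
  - by congr (c _); exact: modn_small.
rewrite hE in x_nondeg x_sign; rewrite -c0 -c1.
have [rho rho1 [v [vn vE v0]]] :=
  unstable_variation oD cD n_gt1 x_traj c'x c'n x_nondeg x_sign.
exists rho; first exact: rho1.
exact: (quasi_periodic_multiplier oD cD n_gt1 x_traj c'x c'n vE vn v0).
Qed.
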